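(* Let $A=(a_1,\dots,a_n)$ be a finite configuration of points in $\mathbb{R}^d$ whose affine span is $\mathbb{R}^d$, let $V=((a_1,1),\dots,(a_n,1))$, let $\mathcal{P}$ be a fine zonotopal tiling of $Z(V)$, let $0\le k\le n-d-1$, and let $\mathcal{P}^{(k)}=\{\Pi_{I,B}\in\mathcal{P}:|I|=k\}$. To each tile $\Pi_{I,B}\in\mathcal{P}^{(k)}$ associate the $d$-variate spline of degree $k$ $$M(\,\cdot\mid\Pi_{I,B}):=M(\,\cdot\mid(a_i)_{i\in I\sqcup B}).$$ Then, for every polynomial $q$ on $\mathbb{R}^d$ of degree at most $k$ with polar form $Q$, $$q(x)=\frac{k!}{(k+d)!}\sum_{\Pi_{I,B}\in\mathcal{P}^{(k)}}Q\big((a_i)_{i\in I}\big)\,\mathrm{vol}^{d+1}(\Pi_{I,B})\,M(x\mid\Pi_{I,B})\qquad\text{for (almost every) }x\in\mathrm{conv}_k(A),$$ where $$\mathrm{conv}_k(A)=\bigcap_{S\subseteq[n],\ |S|=n-k}\mathrm{conv}(\{a_i\}_{i\in S}).$$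
   Context: Notation: $[n]=\{1,\dots,n\}$, $|\cdot|$ is cardinality, $\sqcup$ is disjoint union, $d\ge1$. The configuration $A=(a_1,\dots,a_n)$ is indexed by $[n]$; repeated points and affine dependencies are allowed. Zonotope and tilings: $v_i=(a_i,1)\in\mathbb{R}^{d+1}$, $[0,v_i]=\{\alpha v_i:0\le\alpha\le1\}$, and $Z(V)=\sum_{i=1}^n[0,v_i]$ (Minkowski sum). For disjoint $I,B\subseteq[n]$ with $|B|=d+1$ and $(a_b)_{b\in B}$ affinely independent, the tile is $\Pi_{I,B}=\sum_{i\in I}v_i+\sum_{b\in B}[0,v_b]$; its order is $|I|$. Its faces are $\Pi_{J,C}=\sum_{j\in J}v_j+\sum_{c\in C}[0,v_c]$ with $C\subseteq B$ and $I\subseteq J\subseteq I\sqcup(B\setminus C)$. Tiles and faces are labelled by their index pairs. A fine zonotopal tiling of $Z(V)$ is a collection $\mathcal{P}$ of such tiles forming a polyhedral subdivision of $Z(V)$: the tiles cover $Z(V)$, distinct tiles have disjoint interiors, and any two tiles intersect in a (possibly empty) common face, i.e. one carrying the same label $(J,C)$ in both tiles. Determinants: for $B\subseteq[n]$ with $|B|=d+1$ and $(a_b)_{b\in B}$ affinely independent, $\det(B)>0$ denotes the determinant of the $(d+1)\times(d+1)$ matrix with rows $(a_b,1)$, $b\in B$, ordered so that it is positive; $\det(B)_{b\to x}$ denotes the determinant obtained by replacing the row $(a_b,1)$ by $(x,1)$ in the same position. One has $\mathrm{vol}^{d+1}(\Pi_{I,B})=\det(B)$, where $\mathrm{vol}^{d+1}$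 is $(d+1)$-dimensional volume. Splines: for $X\subseteq[n]$ with $|X|=k+d+1$, the normalized multivariate (simplex) spline $M(x\mid(a_i)_{i\in X})$ is defined recursively as follows. If $(a_i)_{i\in X}$ does not affinely span $\mathbb{R}^d$, it is $0$. Otherwise, if $k=0$, it equals $\frac{d!}{\det(X)}\mathbf{1}_{\mathrm{conv}(\{a_i\}_{i\in X})}(x)$; if $k\ge1$, $$M(x\mid(a_i)_{i\in X})=\frac{k+d}{k}\sum_{b\in B}\frac{\det(B)_{b\to x}}{\det(B)}\,M(x\mid(a_i)_{i\in X\setminus\{b\}}),$$ where $B\subseteq X$ is any subset with $|B|=d+1$ and $(a_b)_{b\in B}$ affinely independent (the result does not depend on $B$, up to a null set of $x$). Polar form: for a polynomial $q$ on $\mathbb{R}^d$ of degree at most $k$, its polar form is the unique function $Q(x_1,\dots,x_k)$ of $k$ variables in $\mathbb{R}^d$ that is symmetric, affine in each argument, and satisfies $Q(x,\dots,x)=q(x)$ (for $k=0$, $Q$ is the constant $q$). *)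

(* Defs.v *)
From HB Require Import structures.
From mathcomp Require Import all_boot all_order perm all_algebra.
From mathcomp Require Import all_classical all_reals all_analysis.
(* mpoly is not imported: its notations clash with those of the analysis
   library. *)
From mathcomp.multinomials Require mpoly.

Set Implicit Arguments.
Unset Strict Implicit.
Unset Printing Implicit Defensive.

Import Order.TTheory GRing.Theory Num.Theory.
Import numFieldNormedType.Exports.

Local Open Scope classical_set_scope.
Local Open Scope ring_scope.

Section Lebesgue.
Context {R : realType}.

Definition box m (l u : 'rV[R]_m) : set 'rV[R]_m :=
  [set x | forall i, l 0 i <= x 0 i <= u 0 i].

(* Lebesgue outer measure on R^m. It agrees with the Lebesgue measure on every
   Lebesgue measurable set (in particular on compact sets), and a set is
   Lebesgue-null exactly when it has outer measure 0. *)
Definition lebesgue m (S : set 'rV[R]_m) : \bar R :=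
  ereal_inf [set s | exists l u : nat -> 'rV[R]_m,
    [/\ forall j i, l j 0 i <= u j 0 i,
        S `<=` \bigcup_j box (l j) (u j)
      & s = (\sum_(j <oo) (\prod_i (u j 0 i - l j 0 i))%:E)%E]].

Definition vol m (S : set 'rV[R]_m) : R := fine (lebesgue S).

Definition ae_in m (D : set 'rV[R]_m) (P : 'rV[R]_m -> Prop) : Prop :=
  lebesgue [set x | D x /\ ~ P x] = 0%E.

End Lebesgue.

Section Configuration.
Context {R : realType} {d n : nat}.
Implicit Types (a : 'I_n -> 'rV[R]_d) (I B C J S X : {set 'I_n}).

Definition conv_hull a S : set 'rV[R]_d :=
  [set x | exists w : 'I_n -> R,
    [/\ forall i, 0 <= w i, \sum_(i in S) w i = 1
      & x = \sum_(i in S) w i *: a i]].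

Definition conv_k a (k : nat) : set 'rV[R]_d :=
  \bigcap_(S in [set S : {set 'I_n} | #|S| = (n - k)%N]) conv_hull a S.

Definition aff_spans a X : Prop :=
  forall x : 'rV[R]_d, exists w : 'I_n -> R,
    \sum_(i in X) w i = 1 /\ x = \sum_(i in X) w i *: a i.

(* Independence of the family indexed by B: two indices of B carrying the same
   point make it dependent. *)
Definition aff_indep a B : Prop :=
  forall w : 'I_n -> R, \sum_(i in B) w i = 0 ->
    \sum_(i in B) w i *: a i = 0 -> forall i, i \in B -> w i = 0.

Definition lift1 (x : 'rV[R]_d) : 'rV[R]_(d + 1) := row_mx x 1%:M.

(* The rows are those of B in increasing order of the indices; meant for
   #|B| = d + 1. *)
Definition rows a B : 'M[R]_(d + 1) :=
  \matrix_(i < d + 1) [seq lift1 (a b) | b in B]`_i.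

(* Reordering the rows so that the determinant becomes positive multiplies it
   by its sign; detB_subst uses the same reordering. *)
Definition detB a B : R := Num.sg (\det (rows a B)) * \det (rows a B).

Definition detB_subst a B (b : 'I_n) (x : 'rV[R]_d) : R :=
  Num.sg (\det (rows a B)) * \det (rows [eta a with b |-> x] B).

(* A choice of the set B used in the spline recursion at each X. *)
Definition basis_choice a (beta : {set 'I_n} -> {set 'I_n}) : Prop :=
  forall X, aff_spans a X ->
    [/\ beta X \subset X, #|beta X| = d.+1 & aff_indep a (beta X)].

(* The spline M(x | (a_i)_{i in X}), meant for #|X| = k + d + 1, computed with
   the sets B chosen by beta. *)
Fixpoint spline a (beta : {set 'I_n} -> {set 'I_n}) (k : nat) X
    (x : 'rV[R]_d) : R :=
  if `[< aff_spans a X >] then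
    match k with
    | 0 => d`!%:R / detB a X * \1_(conv_hull a X) x
    | k'.+1 => (k'.+1 + d)%:R / k'.+1%:R *
        \sum_(b in beta X) detB_subst a (beta X) b x / detB a (beta X) *
          spline a beta k' (X :\ b)%SET x
    end
  else 0.

Definition zonotope a : set 'rV[R]_(d + 1) :=
  [set y | exists2 t : 'I_n -> R, (forall i, 0 <= t i <= 1)
    & y = \sum_i t i *: lift1 (a i)].

Implicit Types L F : {set 'I_n} * {set 'I_n}.

(* The set Pi_{I,B} carried by the label L = (I, B); used for tiles and for
   their faces. *)
Definition tile a L : set 'rV[R]_(d + 1) :=
  [set y | exists2 t : 'I_n -> R, (forall i, 0 <= t i <= 1)
    & y = \sum_(i in L.1) lift1 (a i) + \sum_(b in L.2) t b *: lift1 (a b)].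

Definition is_tile a L : Prop :=
  [/\ [disjoint L.1 & L.2]%B, #|L.2| = d.+1 & aff_indep a L.2].

Definition is_face F L : Prop :=
  [/\ F.2 \subset L.2, L.1 \subset F.1 & F.1 \subset L.1 :|: (L.2 :\: F.2)].

Record fine_tiling a (P : {set {set 'I_n} * {set 'I_n}}) : Prop := {
  tiling_tiles : forall L, L \in P -> is_tile a L;
  tiling_cover : \bigcup_(L in [set L | L \in P]) tile a L = zonotope a;
  tiling_interiors : forall L1 L2, L1 \in P -> L2 \in P -> L1 != L2 ->
    (tile a L1)° `&` (tile a L2)° = set0;
  tiling_faces : forall L1 L2, L1 \in P -> L2 \in P ->
    tile a L1 `&` tile a L2 = set0 \/
    exists F, [/\ is_face F L1, is_face F L2
                & tile a L1 `&` tile a L2 = tile a F]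
}.

End Configuration.

Section Polynomials.
Context {R : realType} {d : nat}.

Definition peval (q : mpoly.mpoly d R) (x : 'rV[R]_d) : R :=
  mpoly.meval (fun i => x 0 i) q.

(* Equivalent to msize q <= k.+1; msize needs canonical instances that are
   only available when mpoly is imported. *)
Definition deg_le (k : nat) (q : mpoly.mpoly d R) : bool :=
  all (fun m => mpoly.mdeg m <= k)%N (mpoly.msupp q).

Definition polar_form k (q : mpoly.mpoly d R) (Q : ('I_k -> 'rV[R]_d) -> R) :
    Prop :=
  [/\ forall (s : {perm 'I_k}) y, Q (y \o s) = Q y,
      forall (i : 'I_k) y (u v : 'rV[R]_d) (t : R),
        Q [eta y with i |-> (1 - t) *: u + t *: v] =
        (1 - t) * Q [eta y with i |-> u] + t * Q [eta y with i |-> v]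
    & forall x, Q (fun=> x) = peval q x].

End Polynomials.

(* Main.v *)
(** For x outside the affine spans of at most d of the points, the right-hand
    side is computed pointwise, by induction on k with the polar form as the
    induction variable. Expanding each M(x | Pi_{I,B}) by the recursion in the
    basis B turns the sum over the tiles of order k into a sum over their facets
    (I, B \ b), where each facet (J, C) contributes the sign of the side on which
    the tile lies, times det(C, x) Q(a_J) M(x | a_J, a_C). An interior facet lies
    in exactly one tile on each side, hence the two contributions cancel when
    both tiles have order k, and otherwise the sum passes to the upper facets
    (I + b, B \ b) of the tiles of order k - 1; there Q is affine in a_b and the
    barycentric coordinates of x in B sum up to Q(a_I, x), the polar form of
    lower order. A boundary facet has the points of J and those outside J on
    opposite sides of its hyperplane, so that its spline vanishes on conv_k up to
    that hyperplane. For k = 0 exactly one tile of order 0 contains a given ray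
    near the origin.

    The recursion holds for every basis because
    sum_b mu_b M(x | X \ b) = 0 for every affine dependence mu on X: in the
    lowest degree the line of representations of x enters and leaves the
    simplex of nonnegative weights once, and the general case follows by
    antisymmetry. *)

Require Import Defs.
From HB Require Import structures.
From mathcomp Require Import all_boot all_order perm all_algebra.
From mathcomp Require Import all_classical all_reals all_analysis.
From mathcomp Require Import measurable_realfun.
From mathcomp.multinomials Require mpoly.
From mathcomp Require Import ring lra.

Set Implicit Arguments.
Unset Strict Implicit.
Unset Printing Implicit Defensive.

Import Order.TTheory GRing.Theory Num.Theory.
Import numFieldNormedType.Exports.

Local Open Scope classical_set_scope.
Local Open Scope ring_scope.

(** * Outer Lebesgue measure *)

Section LebesgueOuterMeasure.
Context {R : realType} {m : nat}.
Implicit Types (S : set 'rV[R]_m) (l u x : 'rV[R]_m) (c : R).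

Definition box_vol l u : R := \prod_i (u 0 i - l 0 i).

Lemma box_vol_ge0 l u : (forall i, l 0 i <= u 0 i) -> 0 <= box_vol l u.
Proof. by move=> lu; apply: prodr_ge0 => i _; rewrite subr_ge0. Qed.

Lemma lebesgue_ge0 S : (0 <= lebesgue S)%E.
Proof.
apply: le_ereal_inf_tmp => _ [l [u [lu _ ->]]].
by apply: nneseries_ge0 => j _ _; rewrite lee_fin; exact: box_vol_ge0.
Qed.

Lemma lebesgue_cover S (l u : nat -> 'rV[R]_m) :
  (forall j i, l j 0 i <= u j 0 i) -> S `<=` \bigcup_j box (l j) (u j) ->
  (lebesgue S <= \sum_(j <oo) (box_vol (l j) (u j))%:E)%E.
Proof. by move=> lu Slu; apply: ereal_inf_lbound; exists l, u. Qed.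

Lemma le_lebesgue S S' : S `<=` S' -> (lebesgue S <= lebesgue S')%E.
Proof.
move=> SS'; apply: ereal_inf_le_tmp => _ [l [u [lu S'lu ->]]].
by exists l, u; split => //; exact: subset_trans S'lu.
Qed.

(** A bijection of [nat] with [nat * nat] flattens the double cover, and a double series of
    nonnegative terms may be summed in any order. *)
Lemma lebesgue_cover2 S (l u : nat -> nat -> 'rV[R]_m) :
  (forall j k i, l j k 0 i <= u j k 0 i) ->
  S `<=` \bigcup_j \bigcup_k box (l j k) (u j k) ->
  (lebesgue S <= \sum_(j <oo) \sum_(k <oo) (box_vol (l j k) (u j k))%:E)%E.
Proof.
move=> lu Slu.
pose f (p : nat * nat) := (box_vol (l p.1 p.2) (u p.1 p.2))%:E.
have f0 p : (0 <= f p)%E by rewrite lee_fin box_vol_ge0.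
have /card_esym/ppcard_eqP[e] := card_nat2.
have Se : S `<=` \bigcup_j box (l (e j).1 (e j).2) (u (e j).1 (e j).2).
  move=> x /Slu[j _ [k _ xjk]].
  by exists (e^-1%FUN (j, k)) => //; rewrite invK ?inE.
apply: (le_trans (lebesgue_cover _ Se)) => [j i|]; first exact: lu.
rewrite nneseries_esumT; last by move=> j; exact: (f0 (e j)).
have -> : (\sum_(j <oo) \sum_(k <oo) (box_vol (l j k) (u j k))%:E =
           \esum_(p in [set: nat] `*`` fun=> [set: nat]) f p)%E.
  rewrite -(esum_esum (a := fun j k => f (j, k))); last by move=> *; exact: f0.
  rewrite nneseries_esumT => [|j]; last first.
    by apply: nneseries_ge0 => k _ _; exact: (f0 (j, k)).
  by apply: eq_esum => j _; rewrite nneseries_esumT// => k; exact: (f0 (j, k)).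
have e_bij : set_bij [set: nat] ([set: nat] `*`` fun=> [set: nat]) e.
  suff -> : [set: nat] `*`` (fun=> [set: nat]) = [set: nat * nat] by exact: bij.
  by apply/seteqP; split.
by rewrite (reindex_esum _ _ _ _ e_bij).
Qed.

Lemma lebesgue_near S c e : (0 < e) -> (lebesgue S <= c%:E)%E ->
  exists l u : nat -> 'rV[R]_m, [/\ forall j i, l j 0 i <= u j 0 i,
    S `<=` \bigcup_j box (l j) (u j)
    & (\sum_(j <oo) (box_vol (l j) (u j))%:E <= (c + e)%:E)%E].
Proof.
move=> e0 Sc.
have : (lebesgue S < (c + e)%:E)%E.
  by rewrite (le_lt_trans Sc)// lte_fin ltrDl.
move=> /ereal_inf_lt[_ [l [u [lu Slu ->]]] ltc].
by exists l, u; split => //; exact: ltW.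
Qed.

(** Covers of the [T j] with excesses [e / 2 ^ j.+1] are merged into one double cover. *)
Lemma lebesgue_sigma_subadditive S (T : nat -> set 'rV[R]_m) (c : nat -> R) :
  S `<=` \bigcup_j T j -> (forall j, (lebesgue (T j) <= (c j)%:E)%E) ->
  (lebesgue S <= \sum_(j <oo) (c j)%:E)%E.
Proof.
move=> ST Tc; apply/lee_addgt0Pr => e e0.
have c0 j : (0 <= (c j)%:E)%E by rewrite (le_trans _ (Tc j)) ?lebesgue_ge0.
apply: le_trans (epsilon_trick xpredT c0 (ltW e0)).
have /= e0' j : 0 < e / (2 ^ j.+1)%:R by rewrite divr_gt0// ltr0n expn_gt0.
have /choice[l /choice[u lu]] j := lebesgue_near (e0' j) (Tc j).
have Slu : S `<=` \bigcup_j \bigcup_k box (l j k) (u j k).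
  by move=> x /ST[j _ /(let: And3 _ b _ := lu j in b)]; exists j.
have lu0 j k i : l j k 0 i <= u j k 0 i by case: (lu j).
apply: le_trans (lebesgue_cover2 lu0 Slu) _.
apply: lee_nneseries => [j _ _|j _]; last by have [] := lu j.
by apply: nneseries_ge0 => k _ _; rewrite lee_fin box_vol_ge0.
Qed.

Lemma lebesgue_fin S N (l u : nat -> 'rV[R]_m) : (0 < m)%N ->
  (forall j i, l j 0 i <= u j 0 i) ->
  (forall x, S x -> exists2 j, (j < N)%N & box (l j) (u j) x) ->
  (lebesgue S <= (\sum_(j < N) box_vol (l j) (u j))%:E)%E.
Proof.
move=> m0 lu Slu.
(* The sequence is completed by the box reduced to the origin, of volume 0 because [m] is positive;
   in dimension 0 the empty product would be 1. *)
pose l' j := if (j < N)%N then l j else 0.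
pose u' j := if (j < N)%N then u j else 0.
apply: (le_trans (lebesgue_cover (l := l') (u := u') _ _)).
- by move=> j i; rewrite /l' /u'; case: ifP => // _; rewrite mxE.
- by move=> x /Slu[j jN xj]; exists j => //; rewrite /l' /u' jN.
rewrite (nneseries_split 0 N) => [|j _]; last first.
  rewrite lee_fin box_vol_ge0// => i; rewrite /l' /u'.
  by case: ifP => // _; rewrite mxE.
rewrite eseries0 ?adde0 => [|j Nj _]; last first.
  rewrite /box_vol /l' /u' ltnNge Nj (bigD1 (Ordinal m0))//= subrr mul0r//.
rewrite add0n big_mkord sumEFin lee_fin le_eqVlt; apply/orP; left; apply/eqP.
by apply: eq_bigr => j _; rewrite /l' /u' ltn_ord.
Qed.

Lemma lebesgue_set0 : (0 < m)%N -> lebesgue (set0 : set 'rV[R]_m) = 0%E.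
Proof.
move=> m0; apply/eqP; rewrite eq_le lebesgue_ge0 andbT.
have := @lebesgue_fin set0 0 (fun=> 0) (fun=> 0) m0.
by rewrite big_ord0; apply.
Qed.

Lemma lebesgue_bigcup0 (I : finType) (A : pred I) (T : I -> set 'rV[R]_m) S :
  (0 < m)%N -> S `<=` \bigcup_(i in [set i | A i]) T i ->
  (forall i, A i -> lebesgue (T i) = 0%E) -> lebesgue S = 0%E.
Proof.
move=> m0 ST T0; apply/eqP; rewrite eq_le lebesgue_ge0 andbT.
pose T' j := [set x | exists2 i, A i & T i x /\ j = enum_rank i :> nat].
have ST' : S `<=` \bigcup_j T' j.
  by move=> x /ST[i /= Ai Tx]; exists (enum_rank i) => //; exists i.
have T'0 j : (lebesgue (T' j) <= 0%:E)%E.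
  have [[i Ai ji]|nj] := pselect (exists2 i, A i & j = enum_rank i :> nat).
    apply: (@le_trans _ _ (lebesgue (T i))); last by rewrite T0.
    apply: le_lebesgue => x [i' _ [Tx ji']].
    have <- : i' = i by apply/enum_rank_inj/val_inj/(etrans (esym ji') ji).
    exact: Tx.
  rewrite (_ : T' j = set0) ?lebesgue_set0//.
  by rewrite -subset0 => x [i Ai [_ ji]]; apply: nj; exists i.
by apply: (le_trans (lebesgue_sigma_subadditive ST' T'0)); rewrite eseries0.
Qed.
End LebesgueOuterMeasure.

(** * Linear images *)

(** The product is a polynomial in t with nonnegative coefficients; on [0, 1] every power of t is at
    most t, so the non-constant part is at most K t. This bounds the volume gained by thickening a
    box. *)
Lemma prod_affine_bound (R : realType) (I : finType) (A : pred I) (w b : I -> R) :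
  (forall i, 0 <= w i) -> (forall i, 0 <= b i) ->
  exists2 K, 0 <= K & forall t, 0 <= t <= 1 ->
    \prod_(i | A i) (w i + b i * t) <= \prod_(i | A i) w i + K * t.
Proof.
move=> w0 b0.
suff bnd s : exists2 K, 0 <= K & forall t, 0 <= t <= 1 ->
    \prod_(i <- s) (w i + b i * t) <= \prod_(i <- s) w i + K * t.
  have [K K0 bK] := bnd [seq i <- index_enum I | A i].
  by exists K => // t /bK; rewrite !big_filter.
elim: s => [|i s [K K0 Kt]].
  by exists 0 => // t _; rewrite !big_nil mul0r addr0.
set p := \prod_(i <- s) w i in Kt *.
have p0 : 0 <= p by exact: prodr_ge0.
exists (w i * K + b i * p + b i * K) => [|t t01].
  by rewrite !addr_ge0// mulr_ge0.
have /andP[t0 t1] := t01; rewrite !big_cons.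
apply: le_trans (ler_wpM2l _ (Kt t t01)) _; first by rewrite addr_ge0// mulr_ge0.
have : b i * K * (t * t) <= b i * K * t by rewrite ler_wpM2l ?mulr_ge0// ler_piMr.
rewrite -/p; nra.
Qed.

Section LinearImage.
Context {R : realType} {m : nat}.
Hypothesis m_gt0 : (0 < m)%N.
Implicit Types (S : set 'rV[R]_m) (l u x r : 'rV[R]_m) (G H T : 'M[R]_m) (c : R).

Definition lmx_image G S : set 'rV[R]_m := [set x *m G | x in S].

(** Only the upper bound is asked for: for an invertible matrix, equality follows by applying it to
    the inverse as well. *)
Definition vol_shrinks G := forall S c, (lebesgue S <= c%:E)%E ->
  (lebesgue (lmx_image G S) <= (`|\det G| * c)%:E)%E.

Lemma vol_shrinks1 : vol_shrinks 1%:M.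
Proof.
move=> S c Sc; rewrite det1 normr1 mul1r; apply: le_trans Sc.
by apply: le_lebesgue => _ [x Sx <-]; rewrite mulmx1.
Qed.

Lemma vol_shrinks_mul G H : vol_shrinks G -> vol_shrinks H -> vol_shrinks (G *m H).
Proof.
move=> sG sH S c Sc; rewrite det_mulmx normrM [_ * `|\det H|]mulrC -mulrA.
apply: le_trans (sH _ _ (sG _ _ Sc)); apply: le_lebesgue => _ [x Sx <-].
by exists (x *m G); [exists x|rewrite mulmxA].
Qed.

Lemma vol_shrinks_box G :
  (forall l u, (forall i, l 0 i <= u 0 i) ->
    (lebesgue (lmx_image G (box l u)) <= (`|\det G| * box_vol l u)%:E)%E) ->
  vol_shrinks G.
Proof.
move=> sG S c Sc; apply/lee_addgt0Pr => e e0.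
(* The added 1 keeps the divisor positive when [G] is singular. *)
have d0 : 0 < `|\det G| + 1 by rewrite ltr_wpDl.
have e0' : 0 < e / (`|\det G| + 1) by rewrite divr_gt0.
have [l [u [lu Slu lec]]] := lebesgue_near e0' Sc.
have SG : lmx_image G S `<=` \bigcup_j lmx_image G (box (l j) (u j)).
  by move=> _ [x /Slu[j _ xj] <-]; exists j => //; exists x.
apply: (le_trans (lebesgue_sigma_subadditive SG (fun j => sG _ _ (lu j)))).
under eq_eseriesr do rewrite EFinM.
rewrite nneseriesZl => [|j _]; last by rewrite lee_fin box_vol_ge0.
have dE : (0 <= `|\det G|%:E)%E by rewrite lee_fin.
apply: (le_trans (lee_wpmul2l dE lec)); rewrite -EFinM -EFinD lee_fin mulrDr lerD2l.
by rewrite mulrCA ler_piMr ?(ltW e0)// ler_pdivrMr// mul1r lerDl.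
Qed.

Lemma vol_shrinks_perm (s : 'S_m) : vol_shrinks (perm_mx s).
Proof.
have sE x i : (x *m perm_mx s) 0 (s i) = x 0 i.
  by rewrite -{1}[s]invgK -col_permE mxE permK.
apply: vol_shrinks_box => l u lu; rewrite det_perm normrX normrN1 expr1n mul1r.
set l' := l *m perm_mx s; set u' := u *m perm_mx s.
have -> : box_vol l u = \sum_(j < 1) box_vol l' u'.
  rewrite big_ord1 /box_vol [RHS](reindex_inj (@perm_inj _ s)).
  by apply: eq_bigr => i _; rewrite !sE.
apply: (lebesgue_fin (l := fun=> l') (u := fun=> u')) => // [j i|_ [x xlu <-]].
  by rewrite -[i](permKV s) !sE.
by exists 0 => // i; rewrite -[i](permKV s) !sE.
Qed.

Lemma mem_subdivision (y w : R) N : 0 <= y <= N.+1%:R * w ->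
  exists2 k, (k < N.+1)%N & k%:R * w <= y <= k.+1%:R * w.
Proof.
elim: N => [|N IH] /andP[y0 yN]; first by exists 0; rewrite // mul0r y0 yN.
have [yN'|yN'] := leP y (N.+1%:R * w); last by exists N.+1 => //; rewrite ltW.
by have [|k kN yk] := IH; [rewrite y0|exists k => //; exact: leq_trans kN _].
Qed.

Definition replace_row (i : 'I_m) r : 'M[R]_m :=
  \matrix_(j, k) if j == i then r 0 k else (j == k)%:R.

Lemma mul_replace_row i r x j :
  (x *m replace_row i r) 0 j = (if j == i then 0 else x 0 j) + x 0 i * r 0 j.
Proof.
rewrite mxE (bigD1 i)//= mxE eqxx addrC; congr (_ + _).
have [->|ji] := eqVneq j i.
  by rewrite big1// => k /negPf ki; rewrite mxE ki mulr0.
rewrite (bigD1 j)//= mxE (negPf ji) eqxx mulr1 big1 ?addr0// => k /andP[ki kj].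
by rewrite mxE (negPf ki) (negPf kj) mulr0.
Qed.

(** The cofactors along row i do not involve that row, hence are those of the identity, read off its
    adjugate. *)
Lemma det_replace_row i r : \det (replace_row i r) = r 0 i.
Proof.
rewrite (expand_det_row _ i).
have cof j : cofactor (replace_row i r) i j = \adj (1%:M : 'M[R]_m) j i.
  rewrite mxE; congr (_ * \det _); apply/matrixP => k k'.
  by rewrite !mxE eq_sym (negPf (neq_lift i k)).
have adj1 : \adj (1%:M : 'M[R]_m) = 1%:M.
  by rewrite -[LHS]mul1mx mul_mx_adj det1.
rewrite (bigD1 i)//= cof adj1 !mxE eqxx mulr1 big1 ?addr0// => j /negPf ji.
by rewrite cof adj1 !mxE ji mulr0.
Qed.

(** The box is cut into [N.+1] slabs of width [w] along coordinate i. The image of a slab is a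
    slanted box, contained in a straight one that is wider by [2 * |r 0 j| * w] in each direction j
    other than i. The total excess tends to 0 as N grows. *)
Lemma vol_shrinks_replace_row i r : vol_shrinks (replace_row i r).
Proof.
apply: vol_shrinks_box => l u lu; rewrite det_replace_row.
pose W := u 0 i - l 0 i.
have W0 : 0 <= W by rewrite subr_ge0.
pose b j := 2 * `|r 0 j| * W.
have b0 j : 0 <= b j by rewrite !mulr_ge0.
have [K K0 bK] := prod_affine_bound (predC1 i)
  (fun j => etrans (subr_ge0 _ _) (lu j)) b0.
have key N : (lebesgue (lmx_image (replace_row i r) (box l u)) <=
    (`|r 0 i| * W * (\prod_(j | j != i) (u 0 j - l 0 j) + K * N.+1%:R^-1))%:E)%E.
  pose w := W / N.+1%:R.
  have w0 : 0 <= w by rewrite divr_ge0.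
  have Nw : N.+1%:R * w = W by rewrite /w mulrC divfK// pnatr_eq0.
  pose y k := l 0 i + k%:R * w.
  (* The minimum and the maximum with 0 account for both signs of [r 0 i]. *)
  pose l' k := \row_j (if j == i then r 0 i * y k + Num.min 0 (r 0 i * w)
    else l 0 j + r 0 j * y k - `|r 0 j| * w).
  pose u' k := \row_j (if j == i then r 0 i * y k + Num.max 0 (r 0 i * w)
    else u 0 j + r 0 j * y k + `|r 0 j| * w).
  have l'u' k j : l' k 0 j <= u' k 0 j.
    rewrite !mxE; case: eqP => _.
      by rewrite lerD2l (@le_trans _ _ 0)// ?ge_min ?le_max lexx.
    rewrite lerBlDr -!addrA !lerD// ?lu// lerDl addr_ge0// ?mulr_ge0//.
  have cover x : lmx_image (replace_row i r) (box l u) x ->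
      exists2 k, (k < N.+1)%N & box (l' k) (u' k) x.
    move=> [z zlu <-].
    have [|k kN yk] := @mem_subdivision (z 0 i - l 0 i) w N.
      by rewrite Nw /W; have := zlu i; lra.
    exists k => // j; rewrite mul_replace_row !mxE.
    have [s zs s0w] : exists2 s, z 0 i = y k + s & 0 <= s <= w.
      exists (z 0 i - y k); first by rewrite addrC subrK.
      by rewrite /y; move: yk; rewrite -natr1; lra.
    have rs : `|r 0 j * s| <= `|r 0 j| * w.
      by rewrite normrM ler_wpM2l// ger0_norm; case/andP: s0w.
    case: eqP => [ji|_].
      case/andP: s0w => s0 sw.
      rewrite ji add0r zs [(y k + s) * _]mulrC [_ * (y k + s)]mulrDr !lerD2l ge_min le_max.
      have [r0|r0] := leP 0 (r 0 i).
        by rewrite mulr_ge0// (ler_wpM2l r0 sw) orbT.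
      by rewrite (ler_wnM2l (ltW r0) sw) orbT (mulr_le0_ge0 (ltW r0) s0).
    have := zlu j; move: rs; rewrite zs ler_norml; nra.
  have vE k : box_vol (l' k) (u' k) =
      `|r 0 i| * w * \prod_(j | j != i) (u 0 j - l 0 j + b j * N.+1%:R^-1).
    rewrite /box_vol (bigD1 i)//= !mxE eqxx; congr (_ * _).
      have [r0|r0] := leP 0 (r 0 i).
        by rewrite ger0_norm// min_l ?max_r ?mulr_ge0//; ring.
      have rw0 := mulr_le0_ge0 (ltW r0) w0.
      by rewrite ltr0_norm// min_r ?max_l//; ring.
    apply: eq_bigr => j /negPf ji; rewrite !mxE ji /b /w; ring.
  apply: (le_trans (lebesgue_fin m_gt0 l'u' cover)); rewrite lee_fin.
  rewrite (eq_bigr _ (fun (k : 'I_N.+1) _ => vE k)).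
  rewrite sumr_const card_ord -[X in X <= _]mulr_natl [N.+1%:R * _]mulrA.
  have -> : N.+1%:R * (`|r 0 i| * w) = `|r 0 i| * W by rewrite -Nw mulrCA.
  by rewrite ler_wpM2l ?mulr_ge0// bK// invr_ge0 ler0n invf_le1// ler1n.
apply/lee_addgt0Pr => e e0.
pose D := `|r 0 i| * W * K.
have D0 : 0 <= D by rewrite !mulr_ge0.
have := archi_boundP (divr_ge0 D0 (ltW e0)); set N := Num.bound _ => DN.
apply: (le_trans (key N)); rewrite -EFinD lee_fin.
have -> : box_vol l u = W * \prod_(j | j != i) (u 0 j - l 0 j).
  by rewrite /box_vol (bigD1 i).
rewrite mulrDr [`|r 0 i| * (W * _)]mulrA lerD2l mulrA -/D ler_pdivrMr//.
have : D < N%:R * e by rewrite -ltr_pdivrMr.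
by rewrite -natr1; nra.
Qed.

(* [lead_rows T k] passes from the identity to T one row at a time; each step
   is a left multiplication by a matrix [replace_row]. *)
Definition lead_rows (T : 'M[R]_m) k : 'M[R]_m :=
  \matrix_(i, j) if (i < k)%N then T i j else (i == j)%:R.

Lemma vol_shrinks_lead_rows T :
  (forall k, lead_rows T k \in unitmx) -> vol_shrinks T.
Proof.
move=> Tu; suff sT k : vol_shrinks (lead_rows T k).
  suff <- : lead_rows T m = T by [].
  by apply/matrixP => i j; rewrite mxE ltn_ord.
elim: k => [|k IH].
  suff -> : lead_rows T 0 = 1%:M by exact: vol_shrinks1.
  by apply/matrixP => i j; rewrite !mxE.
have [km|mk] := ltnP k m; last first.
  suff -> : lead_rows T k.+1 = lead_rows T k by [].
  by apply/matrixP => i j; rewrite !mxE ltnS !(leq_trans _ mk)// ltnW.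
(* [r] holds the coordinates of row k of [T] in the rows of the current matrix; this is where its
   invertibility enters. *)
pose i0 := Ordinal km; pose r := row i0 T *m invmx (lead_rows T k).
suff -> : lead_rows T k.+1 = replace_row i0 r *m lead_rows T k.
  by apply: vol_shrinks_mul => //; exact: vol_shrinks_replace_row.
apply/row_matrixP => i; rewrite row_mul; have [->|ii0] := eqVneq i i0.
  suff -> : row i0 (replace_row i0 r) = r.
    by rewrite mulmxKV//; apply/rowP => j; rewrite !mxE ltnSn.
  by apply/rowP => j; rewrite !mxE eqxx.
suff -> : row i (replace_row i0 r) = delta_mx 0 i.
  rewrite -rowE; apply/rowP => j; rewrite !mxE ltnS leq_eqVlt.
  by rewrite (_ : (i == k :> nat) = false)//; exact: negPf ii0.
by apply/rowP => j; rewrite !mxE (negPf ii0) eqxx eq_sym.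
Qed.

(** All the matrices [lead_rows T k] are triangular with nonzero diagonal, hence invertible; the
    same holds in the upper triangular case. *)
Lemma vol_shrinks_lower T : (forall i j : 'I_m, (i < j)%N -> T i j = 0) ->
  (forall i, T i i != 0) -> vol_shrinks T.
Proof.
move=> T0 Td; apply: vol_shrinks_lead_rows => k.
rewrite unitmxE det_trig; last first.
  apply/is_trig_mxP => i j ij; rewrite mxE T0// -(inj_eq val_inj) ltn_eqF//.
  by case: ifP.
rewrite unitfE prodf_seq_neq0; apply/allP => i _ /=.
by rewrite mxE eqxx; case: ifP => _; rewrite ?Td ?oner_neq0.
Qed.

Lemma vol_shrinks_upper T : (forall i j : 'I_m, (j < i)%N -> T i j = 0) ->
  (forall i, T i i != 0) -> vol_shrinks T.
Proof.
move=> T0 Td; apply: vol_shrinks_lead_rows => k.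
rewrite unitmxE -det_tr det_trig; last first.
  apply/is_trig_mxP => i j ij; rewrite 2!mxE T0// -(inj_eq val_inj) gtn_eqF//.
  by case: ifP.
rewrite unitfE prodf_seq_neq0; apply/allP => i _ /=.
by rewrite 2!mxE eqxx; case: ifP => _; rewrite ?Td ?oner_neq0.
Qed.

End LinearImage.

(** The LUP decomposition reduces an invertible matrix to a permutation matrix and two triangular
    ones with nonzero diagonals. *)
Lemma vol_shrinks_unit (R : realType) m (G : 'M[R]_m) :
  (0 < m)%N -> G \in unitmx -> vol_shrinks G.
Proof.
case: m G => // m G _ Gu.
have := cormen_lup_correct G; have := cormen_lup_perm G.
have := cormen_lup_lower G; have := cormen_lup_upper G.
case: (cormen_lup G) => [[P L] U] /= Uup Llow /is_perm_mxP[s ->{P}] PG.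
have -> : G = perm_mx (s^-1)%g *m (L *m U).
  have <- : perm_mx s *m G = L *m U by [].
  by rewrite mulmxA -perm_mxM mulVg perm_mx1 mul1mx.
have Ld i : L i i = 1 by rewrite Llow// eqxx.
have Ll (i j : 'I_m.+1) : (i < j)%N -> L i j = 0.
  by move=> ij; rewrite Llow 1?ltnW//; case: eqP ij => // ->; rewrite ltnn.
have dU : \det U != 0.
  have : \det (L *m U) != 0.
    have <- : perm_mx s *m G = L *m U by [].
    by rewrite det_mulmx mulf_neq0// -unitfE -unitmxE ?unitmx_perm.
  by rewrite det_mulmx mulf_eq0 negb_or => /andP[].
have Ud i : U i i != 0.
  move: dU; rewrite -det_tr det_trig; last first.
    by apply/is_trig_mxP => j k jk; rewrite mxE Uup.
  by rewrite prodf_seq_neq0 => /allP/(_ i (mem_index_enum _)); rewrite mxE.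
apply: vol_shrinks_mul; first exact: vol_shrinks_perm.
apply: vol_shrinks_mul; first by apply: vol_shrinks_lower => // i; rewrite Ld oner_neq0.
exact: vol_shrinks_upper.
Qed.

(** * Parallelepipeds and hyperplanes *)

(** The pointwise bound is integrated over [0, 1] term by term; each interval meets [0, 1] in length
    at most [q j - p j]. *)
Lemma weighted_interval_cover (R : realType) (c p q : nat -> R) :
  (forall j, 0 <= c j) -> (forall j, p j <= q j) ->
  (forall t : R, 0 <= t <= 1 ->
    (1 <= \sum_(j <oo) (c j * \1_(`[p j, q j] : set R) t)%:E)%E) ->
  (1 <= \sum_(j <oo) (c j * (q j - p j))%:E)%E.
Proof.
move=> c0 pq cov; pose mu := @lebesgue_measure R.
pose D : set R := `[0, 1]%classic.
have mD : measurable D by exact: measurable_itv.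
have h0 j t : (0 <= (c j * \1_(`[p j, q j] : set R) t)%:E)%E.
  by rewrite lee_fin mulr_ge0.
pose h j (t : R) : \bar R := (c j * \1_(`[p j, q j] : set R) t)%:E.
have mh j : measurable_fun D (h j).
  apply/measurable_EFinP; apply: measurable_funM; first exact: measurable_cst.
  exact: measurable_indic.
have <- : (\int[mu]_(t in D) cst 1 t = 1)%E.
  rewrite integral_cst//= /mu lebesgue_measure_itv/= lte_fin ltr01.
  by rewrite oppr0 adde0 mule1.
apply: (@le_trans _ _ (\int[mu]_(t in D)
    \sum_(j <oo) (c j * \1_(`[p j, q j] : set R) t)%:E)%E).
  apply: ge0_le_integral => //.
  by have := @ge0_emeasurable_sum _ _ _ D _ xpredT
      (fun j t _ _ => h0 j t) (fun j _ => mh j).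
rewrite integral_nneseries//; apply: lee_nneseries => [j _ _|j _].
  by apply: integral_ge0 => t _.
have cj : c j < 0 -> `[p j, q j]%classic = set0 :> set R by rewrite ltNge c0.
have /= -> := @integralZl_indic _ _ _ mu _ mD (fun=> `[p j, q j]%classic) (c j) cj
  (measurable_itv _).
rewrite integral_indic// EFinM lee_wpmul2l ?lee_fin//.
apply: (@le_trans _ _ (mu `[p j, q j]%classic)).
  by apply: le_measure; rewrite ?inE//; exact: measurableI.
rewrite /mu lebesgue_measure_itv/= lte_fin.
by case: ifP => _; rewrite -?EFinB// lee_fin subr_ge0.
Qed.

Section CubeAndHyperplane.
Context {R : realType} {m : nat}.
Hypothesis m_gt0 : (0 < m)%N.
Implicit Types (l u x : 'rV[R]_m) (G : 'M[R]_m).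

Definition cube : set 'rV[R]_m := box 0 (const_mx 1).

(** Interpolates between the indicator of the box at x, for k = 0, and its volume, for k = m: the
    first k coordinates have been integrated out. *)
Let partial_vol l u (k : nat) x : R :=
  \prod_(i < m) if (i < k)%N then u 0 i - l 0 i else \1_(`[l 0 i, u 0 i] : set R) (x 0 i).

(* The coordinates are integrated one at a time. *)
Lemma cube_cover_ge1 (l u : nat -> 'rV[R]_m) :
  (forall j i, l j 0 i <= u j 0 i) -> cube `<=` \bigcup_j box (l j) (u j) ->
  (1 <= \sum_(j <oo) (box_vol (l j) (u j))%:E)%E.
Proof.
move=> lu cov.
suff ge1 k x : (k <= m)%N -> cube x ->
    (1 <= \sum_(j <oo) (partial_vol (l j) (u j) k x)%:E)%E.
  have c0 : cube 0 by move=> i; rewrite !mxE lexx ler01.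
  apply: le_trans (ge1 m 0 (leqnn m) c0) _.
  rewrite le_eqVlt; apply/orP; left; apply/eqP; apply: eq_eseriesr => j _.
  by congr _%:E; apply: eq_bigr => i _; rewrite ltn_ord.
have pv0 j k' x' : (0 <= (partial_vol (l j) (u j) k' x')%:E)%E.
  by rewrite lee_fin prodr_ge0// => i _; case: ifP => _; rewrite ?subr_ge0.
elim: k x => [x _ /cov[j _ xj]|k IH x km cx].
  rewrite (@le_trans _ _ (\sum_(0 <= j' < j.+1)
    (partial_vol (l j') (u j') 0 x)%:E)%E)//; last exact: nneseries_lim_ge.
  rewrite big_nat_recr//= -[leLHS]add0e leeD//; first exact: sume_ge0.
  rewrite lee_fin /partial_vol big1// => i _.
  by rewrite indicE mem_set//= in_itv/= xj.
pose i0 := Ordinal km.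
pose c j := \prod_(i | i != i0) if (i < k)%N then u j 0 i - l j 0 i
  else \1_(`[l j 0 i, u j 0 i] : set R) (x 0 i).
have cE j : partial_vol (l j) (u j) k.+1 x = c j * (u j 0 i0 - l j 0 i0).
  rewrite /partial_vol (bigD1 i0)//= ltnSn mulrC; congr (_ * _).
  apply: eq_bigr => i ii0; rewrite ltnS leq_eqVlt.
  by rewrite (_ : (i == k :> nat) = false)//; exact: negPf ii0.
under eq_eseriesr do rewrite cE.
apply: weighted_interval_cover => // [j|t t01].
  by rewrite prodr_ge0// => i _; case: ifP => _; rewrite ?subr_ge0.
(* The induction hypothesis is used at all points [xt] of the segment along which coordinate k of x
   varies. *)
pose xt : 'rV[R]_m := \row_i if i == i0 then t else x 0 i.
have cxt : cube xt by move=> i; have := cx i; rewrite !mxE; case: ifP.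
apply: le_trans (IH xt (ltnW km) cxt) _.
rewrite le_eqVlt; apply/orP; left; apply/eqP; apply: eq_eseriesr => j _.
rewrite /partial_vol (bigD1 i0)//= ltnn mulrC !mxE eqxx; congr (_ * _)%:E.
by apply: eq_bigr => i /negPf ii0; rewrite mxE ii0.
Qed.

Lemma lebesgue_cube : lebesgue cube = 1%E.
Proof.
apply/eqP; rewrite eq_le; apply/andP; split; last first.
  by apply: le_ereal_inf_tmp => _ [l [u [lu cov ->]]]; exact: cube_cover_ge1.
have -> : 1%E = (\sum_(j < 1) box_vol (0 : 'rV[R]_m) (const_mx 1))%:E.
  by rewrite big_ord1 /box_vol big1// => i _; rewrite !mxE subr0.
apply: (lebesgue_fin (l := fun=> 0) (u := fun=> const_mx 1)) => // [_ i|x cx].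
  by rewrite !mxE ler01.
by exists 0.
Qed.

Lemma lebesgue_translate S (v : 'rV[R]_m) (c : R) : (lebesgue S <= c%:E)%E ->
  (lebesgue [set (v + x)%R | x in S] <= c%:E)%E.
Proof.
move=> Sc; apply/lee_addgt0Pr => e e0.
have [l [u [lu Slu lec]]] := lebesgue_near e0 Sc.
rewrite -EFinD; apply: le_trans lec.
have -> : (\sum_(j <oo) (box_vol (l j) (u j))%:E =
    \sum_(j <oo) (box_vol (v + l j) (v + u j))%:E)%E.
  apply: eq_eseriesr => j _; congr _%:E; apply: eq_bigr => i _.
  by rewrite !mxE; ring.
apply: lebesgue_cover => [j i|_ [x /Slu[j _ xj] <-]]; first by rewrite !mxE lerD2l.
by exists j => // i; rewrite !mxE !lerD2l.
Qed.

(** The upper bound comes from [G] applied to the cube, the lower one from the inverse of [G]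
    applied to the parallelepiped, since the cube has measure 1. *)
Lemma lebesgue_parallelepiped G (v : 'rV[R]_m) : G \in unitmx ->
  lebesgue [set (v + x *m G)%R | x in cube] = `|\det G|%:E.
Proof.
move=> Gu; have Gi : invmx G \in unitmx by rewrite unitmx_inv.
have d0 : 0 < `|\det G| by rewrite normr_gt0 -unitfE -unitmxE.
apply/eqP; rewrite eq_le; apply/andP; split.
  have c1 : (lebesgue cube <= 1%:E)%E by rewrite lebesgue_cube.
  have := vol_shrinks_unit m_gt0 Gu c1; rewrite mulr1 => /(lebesgue_translate v).
  apply: le_trans; apply: le_lebesgue => _ [x cx <-].
  by exists (x *m G) => //; exists x.
set S := (X in lebesgue X).
have := lebesgue_ge0 S; case E : (lebesgue S) => [c| |]; rewrite ?leey// => _.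
rewrite lee_fin; have SE : (lebesgue S <= c%:E)%E by rewrite E.
have := lebesgue_translate (- v) SE => /(vol_shrinks_unit m_gt0 Gi)/(le_trans _) Sc.
have : (1 <= (`|\det (invmx G)| * c)%:E)%E.
  rewrite -lebesgue_cube; apply: Sc; apply: le_lebesgue => x cx.
  exists (x *m G); last by rewrite mulmxK.
  by exists (v + x *m G); [exists x|rewrite addKr].
by rewrite lee_fin det_inv normfV mulrC ler_pdivlMr// mul1r.
Qed.

(** Boxes that are flat in direction i and grow in the others exhaust the set; each has volume 0. *)
Lemma lebesgue_coord_eq (i : 'I_m) (c : R) :
  lebesgue [set x : 'rV[R]_m | x 0 i = c] = 0%E.
Proof.
apply/eqP; rewrite eq_le lebesgue_ge0 andbT.
pose l (j : nat) : 'rV[R]_m := \row_k if k == i then c else - j%:R.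
pose u (j : nat) : 'rV[R]_m := \row_k if k == i then c else j%:R.
have lu j k : l j 0 k <= u j 0 k.
  by rewrite !mxE; case: ifP => // _; apply: (@le_trans _ _ 0); rewrite ?oppr_le0 ler0n.
apply: (le_trans (lebesgue_cover lu _)); last first.
  rewrite eseries0// => j _ _.
  by rewrite /box_vol (bigD1 i)//= !mxE eqxx subrr mul0r.
move=> x /= xc; pose M := \sum_k `|x 0 k|.
have M0 : 0 <= M by exact: sumr_ge0.
exists (Num.bound M) => // k; rewrite !mxE; case: eqP => [->|_]; first by rewrite xc lexx.
rewrite -ler_norml (le_trans _ (ltW (archi_boundP M0)))//.
by rewrite /M (bigD1 k)//= lerDl sumr_ge0.
Qed.

(** With [w i] nonzero, an invertible change of coordinates turns the linear form [w] into
    coordinate i. *)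
Lemma lebesgue_hyperplane (w : 'cV[R]_m) (c : R) : w != 0 ->
  lebesgue [set x : 'rV[R]_m | (x *m w) 0 0 = c] = 0%E.
Proof.
move=> /cV0Pn[i wi]; set H := [set x | _].
pose G : 'M[R]_m := \matrix_(j, k) if k == i then w j 0 else (j == k)%:R.
have GE x : (x *m G) 0 i = (x *m w) 0 0.
  by rewrite !mxE; apply: eq_bigr => j _; rewrite mxE eqxx.
have dG : \det G = w i 0.
  rewrite -det_tr (_ : G^T = replace_row i w^T) ?det_replace_row ?mxE//.
  by apply/matrixP => j k; rewrite !mxE [k == j]eq_sym.
have Gu : G \in unitmx by rewrite unitmxE dG unitfE.
have Gi : invmx G \in unitmx by rewrite unitmx_inv.
pose Hi := [set x : 'rV[R]_m | x 0 i = c].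
have c0 : (lebesgue Hi <= 0%:E)%E by rewrite lebesgue_coord_eq.
apply/eqP; rewrite eq_le lebesgue_ge0 andbT.
have := vol_shrinks_unit m_gt0 Gi c0; rewrite mulr0; apply: le_trans.
apply: le_lebesgue => x Hx; exists (x *m G); last by rewrite mulmxK.
by rewrite /Hi /= GE.
Qed.

End CubeAndHyperplane.

(** * Coordinates in a basis of lifted points *)

Definition mx_of_rows (R : realType) m (s : seq 'rV[R]_m) : 'M[R]_m :=
  \matrix_(i < m) s`_i.

(** The sign is chosen before [f]: it has to be the same for a configuration and for that
    configuration with one point replaced. *)
Lemma perm_det_mx_of_rows (R : realType) m (I : eqType) (s t : seq I) :
  perm_eq s t -> size s = m -> exists2 e : R, e = 1 \/ e = -1 &
    forall f : I -> 'rV[R]_m,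
      \det (mx_of_rows (map f s)) = e * \det (mx_of_rows (map f t)).
Proof.
move=> st sm; have tm : size t == m by rewrite -(perm_size st) sm.
have /tuple_permP[p sE] : perm_eq s (Tuple tm) by [].
exists ((-1) ^+ p); first by case: (odd_perm p); [right|left].
move=> f; rewrite -det_perm -det_mulmx -row_permE; congr (\det _).
apply/matrixP => i j; rewrite !mxE; congr (fun_of_matrix _ 0 j).
pose x0 := tnth (Tuple tm) i.
rewrite !(nth_map x0) ?sm// ?(eqP tm)//.
by rewrite sE -tnth_nth tnth_mktuple (tnth_nth x0).
Qed.

Section LinearFunctional.
Context {R : realType} {m : nat}.
Hypothesis m_gt0 : (0 < m)%N.
Implicit Types (s : seq 'rV[R]_m) (x y : 'rV[R]_m).

Lemma det_cons_linear s c x y :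
  \det (mx_of_rows (c *: x + y :: s)) =
  c * \det (mx_of_rows (x :: s)) + \det (mx_of_rows (y :: s)).
Proof.
rewrite -[X in _ = _ + X]mul1r; pose i0 := Ordinal m_gt0.
apply: (determinant_multilinear (i0 := i0)); first by rewrite !rowK/= scale1r.
  by apply/matrixP => i j; rewrite !mxE.
by apply/matrixP => i j; rewrite !mxE.
Qed.

Lemma det_cons_mem s x : (size s).+1 = m -> x \in s ->
  \det (mx_of_rows (x :: s)) = 0.
Proof.
move=> sm xs; have im : ((index x s).+1 < m)%N 
  by apply: leq_trans (eq_leq sm); rewrite ltnS index_mem.
apply: (determinant_alternate (i1 := Ordinal m_gt0) (i2 := Ordinal im)) => // j.
by rewrite !mxE/= nth_index.
Qed.

Lemma det_cons_sum (I : finType) (A : pred I) (w : I -> R) (f : I -> 'rV[R]_m) s :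
  \det (mx_of_rows (\sum_(i | A i) w i *: f i :: s)) =
  \sum_(i | A i) w i * \det (mx_of_rows (f i :: s)).
Proof.
have det0 : \det (mx_of_rows (0 :: s)) = 0.
  have := det_cons_linear s 1 0 0; rewrite scaler0 addr0 mul1r.
  by rewrite -[LHS]addr0 => /addrI.
elim/big_rec2: _ => // i _ y _ <-.
by rewrite det_cons_linear.
Qed.
End LinearFunctional.

Lemma sum_if_subset (V : nmodType) (I : finType) (B X : {set I}) (F : I -> V) :
  B \subset X ->
  \sum_(i in X) (if i \in B then F i else 0) = \sum_(i in B) F i.
Proof.
move=> BX; rewrite -big_mkcondr; apply: eq_bigl => i.
by case iB: (i \in B); rewrite ?andbF// (fintype.subsetP BX).
Qed.

Section Lifting.
Context {R : realType} {d n : nat}.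
Variable a : 'I_n -> 'rV[R]_d.
Implicit Types (B C X : {set 'I_n}) (x : 'rV[R]_d) (y : 'rV[R]_(d + 1)).
Implicit Types (t w : 'I_n -> R) (i b c : 'I_n).

Let d1_gt0 : (0 < d + 1)%N. Proof. by rewrite addn1. Qed.

(** The last coordinate of a combination of lifted points records the sum of the weights, which
    turns affine statements into linear ones. *)
Lemma sum_lift1 (A : pred 'I_n) w :
  \sum_(i | A i) w i *: lift1 (a i) =
  row_mx (\sum_(i | A i) w i *: a i) (\sum_(i | A i) w i)%:M.
Proof.
elim/big_rec3: _ => [|i x y z _ ->]; first by rewrite raddf0 row_mx0.
by rewrite /lift1 scale_row_mx add_row_mx scalemx1 raddfD.
Qed.

Lemma lift1_sumP (A : pred 'I_n) w x :
  \sum_(i | A i) w i *: lift1 (a i) = lift1 x <->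
  \sum_(i | A i) w i = 1 /\ \sum_(i | A i) w i *: a i = x.
Proof.
rewrite sum_lift1 /lift1; split=> [/eq_row_mx[-> e]|[-> ->//]].
by split=> //; have := congr1 (fun M : 'M[R]_1 => M 0 0) e; rewrite !mxE eqxx.
Qed.

Lemma sum_lift1_eq0 (A : pred 'I_n) w :
  \sum_(i | A i) w i *: lift1 (a i) = 0 <->
  \sum_(i | A i) w i = 0 /\ \sum_(i | A i) w i *: a i = 0.
Proof.
rewrite sum_lift1; split=> [e|[-> ->]]; last by rewrite raddf0 row_mx0.
have /eq_row_mx[-> {}e] := etrans e (esym (row_mx0 _ _ _ _)).
by split=> //; have := congr1 (fun M : 'M[R]_1 => M 0 0) e; rewrite !mxE eqxx.
Qed.

Lemma aff_indep_lift B w : aff_indep a B ->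
  \sum_(i in B) w i *: lift1 (a i) = 0 -> forall i, i \in B -> w i = 0.
Proof. by move=> aB /sum_lift1_eq0[w0 wa0]; exact: aB. Qed.

Lemma aff_indep_inj B t w : aff_indep a B ->
  \sum_(i in B) t i *: lift1 (a i) = \sum_(i in B) w i *: lift1 (a i) ->
  forall i, i \in B -> t i = w i.
Proof.
move=> aB /eqP; rewrite -subr_eq0 -sumrB => /eqP tw i iB; apply/eqP.
rewrite -subr_eq0; apply/eqP; move: i iB.
apply: (@aff_indep_lift B (fun i => t i - w i)) => //.
by rewrite -[RHS]tw; apply: eq_bigr => i _; rewrite scalerBl.
Qed.

(** [r] and [s] translate between row numbers and elements of [B], so that row vectors become
    families of weights on [B]. *)
Lemma rows_indexing B : #|B| = d.+1 ->
  exists (r : 'I_n -> 'I_(d + 1)) (s : 'I_(d + 1) -> 'I_n),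
  [/\ forall j, s j \in B, cancel s r, {in B, cancel r s} &
    forall z, z *m rows a B = \sum_(i in B) z 0 (r i) *: lift1 (a i)].
Proof.
move=> cB; have cB1 : #|B| = (d + 1)%N by rewrite addn1.
have [i0 i0B] : exists i, i \in B by apply/set0Pn; rewrite -card_gt0 cB.
exists (fun i => cast_ord cB1 (enum_rank_in i0B i)).
exists (fun j => enum_val (cast_ord (esym cB1) j)); split=> [j|j|i iB|z].
- exact: enum_valP.
- by rewrite enum_valK_in cast_ordKV.
- by rewrite cast_ordK enum_rankK_in.
rewrite (big_enum_val (fun i => z 0 (cast_ord cB1 (enum_rank_in i0B i)) *: lift1 (a i))).
rewrite mulmx_sum_row (reindex (cast_ord cB1))/=; last first.
  by exists (cast_ord (esym cB1)) => i _; rewrite ?cast_ordK ?cast_ordKV.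
apply: eq_bigr => i _; rewrite enum_valK_in rowK (nth_map i0) ?(enum_val_nth i0)//.
by rewrite -cardE; exact: ltn_ord i.
Qed.

Lemma rows_unitmx B : aff_indep a B -> #|B| = d.+1 -> rows a B \in unitmx.
Proof.
move=> aB cB; rewrite unitmxE unitfE; apply/det0P => -[z z0 zB].
have [r [s [sB rK _ rowsE]]] := rows_indexing cB.
case/rV0Pn: z0 => j /eqP[]; rewrite -(rK j).
by apply: (aff_indep_lift (w := fun i => z 0 (r i)) aB); rewrite -?rowsE.
Qed.

Lemma coords_exist B y : aff_indep a B -> #|B| = d.+1 ->
  exists t, y = \sum_(i in B) t i *: lift1 (a i).
Proof.
move=> aB cB; have [r [s [_ _ _ rowsE]]] := rows_indexing cB.
exists (fun i => (y *m invmx (rows a B)) 0 (r i)).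
by rewrite -rowsE mulmxKV// rows_unitmx.
Qed.

Lemma aff_spansW B X : B \subset X -> aff_spans a B -> aff_spans a X.
Proof.
move=> BX aB x; have [w [w1 wx]] := aB x.
exists (fun i => if i \in B then w i else 0).
split; first by rewrite sum_if_subset.
rewrite wx -(sum_if_subset _ BX); apply: eq_bigr => i _; case: ifP => // _.
by rewrite scale0r.
Qed.

Lemma aff_indep_spans B : aff_indep a B -> #|B| = d.+1 -> aff_spans a B.
Proof.
move=> aB cB x; have [w /esym/lift1_sumP[w1 wx]] := coords_exist (lift1 x) aB cB.
by exists w.
Qed.

(** When [C] indexes d independent points, this is the linear form whose kernel is the hyperplane
    spanned by their lifts; its sign tells the two sides apart. *)
Definition facet_form C y : R :=
  \det (mx_of_rows (y :: [seq lift1 (a c) | c in C])).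

Lemma facet_form_sum (I : finType) (A : pred I) C (w : I -> R) f :
  facet_form C (\sum_(i | A i) w i *: f i) =
  \sum_(i | A i) w i * facet_form C (f i).
Proof. exact: det_cons_sum. Qed.

Lemma facet_formZ C (k : R) y : facet_form C (k *: y) = k * facet_form C y.
Proof.
have := facet_form_sum xpredT C (fun _ : 'I_1 => k) (fun=> y).
by rewrite !big_ord1.
Qed.

Lemma facet_form_mem C c : #|C| = d -> c \in C -> facet_form C (lift1 (a c)) = 0.
Proof.
move=> cC cinC; apply: det_cons_mem => //; first by rewrite size_map -cardE cC addn1.
by apply: map_f; rewrite mem_enum.
Qed.

(** The form vanishes on the lifts of [C], so up to a constant factor it reads off the coordinate of
    b. *)
Lemma facet_form_basis C b t : #|C| = d -> b \notin C ->
  facet_form C (\sum_(i in b |: C) t i *: lift1 (a i)) =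
  t b * facet_form C (lift1 (a b)).
Proof.
move=> cC bC; rewrite facet_form_sum big_setU1//= big1 ?addr0// => i iC.
by rewrite facet_form_mem ?mulr0.
Qed.

Lemma det_rows_facet_form C b : #|C| = d -> b \notin C ->
  exists2 e : R, e = 1 \/ e = -1 &
    \det (rows a (b |: C)) = e * facet_form C (lift1 (a b)) /\
    forall x, \det (rows [eta a with b |-> x] (b |: C)) = e * facet_form C (lift1 x).
Proof.
move=> cC bC.
have bCE : perm_eq (enum (b |: C)) (b :: enum C).
  apply: uniq_perm; rewrite ?enum_uniq//= ?mem_enum ?bC ?enum_uniq//.
  by move=> i; rewrite mem_enum in_setU1 inE mem_enum.
have sz : size (enum (b |: C)) = (d + 1)%N by rewrite -cardE cardsU1 bC cC addnC.
have [e e1 eE] := @perm_det_mx_of_rows R _ _ _ _ bCE sz.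
exists e => //; split=> [|x]; first exact: (eE (fun i => lift1 (a i))).
rewrite [LHS](eE (fun i => lift1 ([eta a with b |-> x] i)))/= eqxx.
congr (e * \det (mx_of_rows (_ :: _))); apply/eq_in_map => i.
by rewrite mem_enum => iC; case: eqP => // ib; rewrite -ib iC in bC.
Qed.

Lemma detB_facet_form C b : #|C| = d -> b \notin C ->
  detB a (b |: C) = `|facet_form C (lift1 (a b))|.
Proof.
move=> cC bC; have [e e1 [eb _]] := det_rows_facet_form cC bC.
by rewrite /detB -normrEsg eb normrM; case: e1 => ->; rewrite ?normrN normr1 mul1r.
Qed.

Lemma detB_subst_facet_form C b x : #|C| = d -> b \notin C ->
  detB_subst a (b |: C) b x =
  Num.sg (facet_form C (lift1 (a b))) * facet_form C (lift1 x).
Proof.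
move=> cC bC; have [e e1 [eb ex]] := det_rows_facet_form cC bC.
rewrite /detB_subst eb ex sgrM.
by case: e1 => ->; rewrite ?sgrN sgr1 ?mulN1r ?mul1r// !(mulrN, mulNr) opprK.
Qed.

Lemma facet_form_neq0 C b : #|C| = d -> b \notin C -> aff_indep a (b |: C) ->
  facet_form C (lift1 (a b)) != 0.
Proof.
move=> cC bC aB; have [e e1 [eb _]] := det_rows_facet_form cC bC.
have : rows a (b |: C) \in unitmx by rewrite rows_unitmx// cardsU1 bC cC.
by rewrite unitmxE unitfE eb mulf_eq0 negb_or => /andP[].
Qed.

Lemma detB_gt0 B : aff_indep a B -> #|B| = d.+1 -> 0 < detB a B.
Proof.
move=> aB cB; rewrite /detB -normrEsg normr_gt0 -unitfE -unitmxE.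
exact: rows_unitmx.
Qed.

(** Cramer's rule, obtained by evaluating the form of the remaining rows at the lift of x. *)
Lemma detB_subst_coords B t x b : aff_indep a B -> #|B| = d.+1 ->
  lift1 x = \sum_(i in B) t i *: lift1 (a i) -> b \in B ->
  detB_subst a B b x = detB a B * t b.
Proof.
move=> aB cB xt bB; move: aB xt; rewrite -(finset.setD1K bB) => aB xt.
have bC : b \notin (B :\ b)%SET by rewrite !inE eqxx.
have cC : #|(B :\ b)%SET| = d by move: cB; rewrite (cardsD1 b) bB => -[].
rewrite detB_subst_facet_form// detB_facet_form// xt facet_form_basis//.
by rewrite normrEsg mulrAC mulrA.
Qed.
End Lifting.

(** * The spline recursion in an arbitrary basis *)

(** By injectivity each sign occurs at most once, and either occurrence forces the other, so the sum
    is empty or 1 - 1. It serves for the two ends of a segment and for the two tiles at a facet. *)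
Lemma sum_signs (R : realType) (T : finType) (A : pred T) (s : T -> R) :
  (forall t, A t -> s t = 1 \/ s t = -1) ->
  (forall t t', A t -> A t' -> s t = s t' -> t = t') ->
  (forall t, A t -> exists2 t', A t' & s t' = - s t) ->
  \sum_(t | A t) s t = 0.
Proof.
move=> s1 s_inj s_opp; have [[t1 At1]|nA] := pselect (exists t, A t); last first.
  by rewrite big_pred0// => t; apply/negP => At; apply: nA; exists t.
have [t2 At2 st2] := s_opp t1 At1.
have t21 : t2 != t1.
  apply/eqP => t21; move: st2; rewrite t21.
  by case: (s1 _ At1) => ->; lra.
rewrite (bigD1 t1)//= (bigD1 t2)/= ?At2// st2 addrA subrr add0r.
rewrite big_pred0// => t; apply/negP => /andP[/andP[At /eqP tt1] /eqP tt2].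
have := s1 _ At; have := s1 _ At1.
by case=> st1 [] st; [apply: tt1|apply: tt2|apply: tt2|apply: tt1];
  apply: s_inj => //; rewrite ?st2 st st1 ?opprK.
Qed.

(* On the line of the weights [c - t *: mu], the value [t = c b / mu b] is the
   one at which coordinate b vanishes. The nonnegative weights form a segment,
   which is left through one coordinate with [mu > 0] at one end and through
   one coordinate with [mu < 0] at the other. *)
Section SegmentEnds.
Context {R : realType} {I : finType}.
Variables (X : {set I}) (c : I -> R).
Implicit Types (mu : I -> R).

Let nneg mu b := [forall i in X, 0 <= c i - c b / mu b * mu i].

(** A coordinate with [mu i < 0] imposes [t >= c i / mu i]. Such coordinates exist because [mu] sums
    to 0, and the largest of these ratios is the lower end of the segment. *)
Let opposite_end mu b : \sum_(i in X) mu i = 0 -> b \in X -> 0 < mu b ->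
  nneg mu b -> exists b', [/\ b' \in X, mu b' < 0 & nneg mu b'].
Proof.
move=> mu0 bX mub /'forall_implyP bn.
have [i0 /andP[i0X mui0]] : exists i, (i \in X) && (mu i < 0).
  apply: contrapT => nneg_mu; move: mu0; rewrite (bigD1 b)//= => mu0.
  suff : 0 < mu b + \sum_(i in X | i != b) mu i by rewrite mu0 ltxx.
  rewrite ltr_pwDl// sumr_ge0// => i /andP[iX _]; rewrite leNgt; apply/negP => mui.
  by apply: nneg_mu; exists i; rewrite iX.
have : (i0 \in X) && (mu i0 < 0) by rewrite i0X.
case/(@Order.TotalTheory.arg_maxP _ _ _ i0 (fun i => (i \in X) && (mu i < 0)) (fun i => c i / mu i)).
move=> b' /andP[b'X mub'] b'max; exists b'; split=> //.
apply/'forall_implyP => i iX.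
have := bn _ b'X; have := bn _ iX.
set t := c b / mu b; set t' := c b' / mu b'.
have -> : c b' = t' * mu b' by rewrite divfK// lt_eqF.
move=> ti tt'; have {}tt' : t' <= t by nra.
have [mui|mui|mui] := ltrgtP (mu i) 0; last by move: ti; rewrite mui !mulr0.
  have : c i / mu i <= t' by apply: b'max; rewrite iX.
  by rewrite ler_ndivrMr// subr_ge0.
by nra.
Qed.

(** The second hypothesis says that no two coordinates vanish at the same time, so each end of the
    segment belongs to a single index. *)
Lemma sum_sg_segment_ends mu : \sum_(i in X) mu i = 0 ->
  (forall b i, b \in X -> i \in X -> i != b -> mu b != 0 ->
    c i - c b / mu b * mu i != 0) ->
  \sum_(b in X | (mu b != 0) && [forall i in X, 0 <= c i - c b / mu b * mu i])
    Num.sg (mu b) = 0.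
Proof.
move=> mu0 gen; apply: sum_signs => [b|b b'|b].
- by case/and3P => _ mub _; have [b0|b0|b0] := ltrgtP (mu b) 0;
    [right; rewrite ltr0_sg|left; rewrite gtr0_sg|rewrite b0 eqxx in mub].
- case/and3P => bX mub /'forall_implyP bn /and3P[b'X mub' /'forall_implyP b'n] sbb'.
  apply/eqP; apply: contraT => bb'; have := gen b b' bX b'X; rewrite eq_sym bb' mub.
  move=> /(_ isT isT)/negP[]; have := bn _ b'X; have := b'n _ bX.
  set t := c b / mu b; set t' := c b' / mu b'.
  have -> : c b = t * mu b by rewrite divfK.
  have -> : c b' = t' * mu b' by rewrite divfK.
  move=> h1 h2; rewrite -mulrBl mulf_eq0 subr_eq0 (negPf mub') orbF.
  move: sbb' mub mub'; have [m1|m1|m1] := ltrgtP (mu b) 0; last by [].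
    rewrite (ltr0_sg m1); have [m2|m2|m2] := ltrgtP (mu b') 0; last by [].
      by move=> _ _ _; apply/eqP; nra.
    by rewrite (gtr0_sg m2) => /eqP; lra.
  rewrite (gtr0_sg m1); have [m2|m2|m2] := ltrgtP (mu b') 0; last by [].
    by rewrite (ltr0_sg m2) => /eqP; lra.
  by move=> _ _ _; apply/eqP; nra.
case/and3P => bX mub bn; have [b0|b0|b0] := ltrgtP (mu b) 0.
(* Negating [mu] exchanges the two ends but leaves the weights [c i - c b / mu b * mu i]
   unchanged. *)
- have nn i : nneg (\- mu) i = nneg mu i.
    by apply: eq_forallb => j /=; rewrite invrN !(mulrN, mulNr) !opprK.
  have [||||b' [b'X b'0]] := @opposite_end (\- mu) b.
  + by rewrite sumrN mu0 oppr0.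
  + by [].
  + by rewrite oppr_gt0.
  + by rewrite nn.
  rewrite oppr_lt0 in b'0; rewrite nn => b'n.
  exists b'; first by apply/and3P; split; rewrite // gt_eqF.
  by rewrite gtr0_sg// ltr0_sg// opprK.
- have [b' [b'X b'0 b'n]] := opposite_end mu0 bX b0 bn.
  exists b'; first by apply/and3P; split; rewrite // lt_eqF.
  by rewrite ltr0_sg// gtr0_sg.
- by rewrite b0 eqxx in mub.
Qed.
End SegmentEnds.

(** * Splines at generic points *)

Section Splines.
Context {R : realType} {d n : nat}.
Variables (a : 'I_n -> 'rV[R]_d) (beta : {set 'I_n} -> {set 'I_n}).
Hypothesis hbeta : basis_choice a beta.
Implicit Types (B C X Y : {set 'I_n}) (x : 'rV[R]_d) (c w mu t : 'I_n -> R).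

Local Notation v i := (lift1 (a i)).
Local Notation M := (spline a beta).

Lemma spline_nspan k X x : ~ aff_spans a X -> M k X x = 0.
Proof. by case: k => [|k] /= nX; rewrite asboolF. Qed.

Lemma conv_hullW X Y x : X \subset Y -> conv_hull a X x -> conv_hull a Y x.
Proof.
move=> XY [w [w0 w1 ->]].
exists (fun i => if i \in X then w i else 0); split=> [i||].
- by case: ifP.
- by rewrite sum_if_subset.
by rewrite -(sum_if_subset _ XY); apply: eq_bigr => i _; case: ifP => // _; rewrite scale0r.
Qed.

Lemma spline_supp k X x : ~ conv_hull a X x -> M k X x = 0.
Proof.
elim: k X => [|k IH] X nX /=; case: asboolP => // _.
  by rewrite indicE memNset// mulr0.
rewrite big1 ?mulr0// => b _; rewrite IH ?mulr0// => /conv_hullW cX.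
by apply/nX/cX; rewrite subsetDl.
Qed.

Lemma aff_spans_indep X : aff_spans a X -> #|X| = d.+1 -> aff_indep a X.
Proof.
move=> aX cX; have [sub cB aB] := hbeta aX.
suff <- : beta X = X by [].
by apply/eqP; rewrite eqEcard sub cB cX /=.
Qed.

Lemma sum_coord0 (b : 'I_n) X w : b \in X -> w b = 0 ->
  \sum_(i in X) w i *: v i = \sum_(i in (X :\ b)%SET) w i *: v i.
Proof. by move=> bX wb; rewrite (big_setD1 b)//= wb scale0r add0r. Qed.

Lemma sum_shift X c mu (s : R) : \sum_(i in X) mu i *: v i = 0 ->
  \sum_(i in X) (c i - s * mu i) *: v i = \sum_(i in X) c i *: v i.
Proof.
move=> mu0; under eq_bigr do rewrite scalerBl -scalerA.
by rewrite sumrB -scaler_sumr mu0 scaler0 subr0.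
Qed.

(** Subtracting the multiple of the dependence that cancels coordinate b drops b without changing
    the represented vector. *)
Lemma sum_elim (b : 'I_n) X c mu : b \in X -> mu b != 0 ->
  \sum_(i in X) mu i *: v i = 0 ->
  \sum_(i in (X :\ b)%SET) (c i - c b / mu b * mu i) *: v i =
  \sum_(i in X) c i *: v i.
Proof.
move=> bX mub mu0; rewrite -(sum_shift c (c b / mu b) mu0) -sum_coord0//.
by rewrite divfK ?subrr.
Qed.

Lemma aff_spans_elim (b : 'I_n) X mu : aff_spans a X -> b \in X -> mu b != 0 ->
  \sum_(i in X) mu i *: v i = 0 -> aff_spans a (X :\ b)%SET.
Proof.
move=> aX bX mub mu0 x; have [c [c1 cx]] := aX x.
have /(lift1_sumP a) cX := conj c1 (esym cx).
rewrite -(sum_elim c bX mub mu0) in cX.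
by have [w1 wx] := (lift1_sumP a _ _ _).1 cX; eexists; split; [exact: w1|].
Qed.

(** The excluded points form finitely many affine subspaces of dimension below d; off them the
    spline identities hold pointwise. *)
Definition generic x := forall C w, (#|C| <= d)%N ->
  \sum_(i in C) w i *: v i <> lift1 x.

Variable x : 'rV[R]_d.
Hypothesis gen : generic x.

Lemma generic_coord_neq0 X b w : (#|X| <= d.+1)%N -> b \in X ->
  \sum_(i in X) w i *: v i = lift1 x -> w b != 0.
Proof.
move=> cX bX wx; apply/eqP => wb; rewrite (sum_coord0 bX wb) in wx.
by apply: gen wx; rewrite -ltnS (leq_trans _ cX)// [leqRHS](cardsD1 b) bX.
Qed.

Lemma conv_hull_coords X w : aff_indep a X -> \sum_(i in X) w i *: v i = lift1 x ->
  conv_hull a X x <-> forall i, i \in X -> 0 <= w i.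
Proof.
move=> aX wx; split=> [[u [u0 u1 xu]] i iX|w0].
  have /(lift1_sumP a) ux := conj u1 (esym xu).
  by rewrite -(aff_indep_inj aX (etrans ux (esym wx)) iX).
have [w1 xw] := (lift1_sumP a _ _ _).1 wx.
exists (fun i => if i \in X then w i else 0); split=> [i||].
- by case: ifP => // /w0.
- by rewrite -[RHS]w1; apply: eq_bigr => i ->.
by rewrite -xw; apply: eq_bigr => i ->.
Qed.

(** The form of the d points of X other than b and b' is applied to the dependence; only the terms
    of b and b' survive. *)
Lemma detB_ratio X mu b b' : #|X| = d.+2 -> \sum_(i in X) mu i *: v i = 0 ->
  b \in X -> b' \in X ->
  `|mu b| * detB a (X :\ b')%SET = `|mu b'| * detB a (X :\ b)%SET.
Proof.
move=> cX mu0 bX b'X; have [->//|bb'] := eqVneq b b'.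
pose C := (X :\ b :\ b')%SET.
have b'Xb : b' \in (X :\ b)%SET by rewrite !inE eq_sym bb'.
have cC : #|C| = d.
  by move: cX; rewrite (cardsD1 b) bX (cardsD1 b') b'Xb => -[].
have bC : b \notin C by rewrite !inE eqxx andbF.
have b'C : b' \notin C by rewrite !inE eqxx.
have XbE : (X :\ b = b' |: C)%SET by rewrite finset.setD1K.
have Xb'E : (X :\ b' = b |: C)%SET.
  by apply/setP => i; rewrite !inE; case: (eqVneq i b) => [->|]; rewrite ?bb' ?bX ?andTb.
have : facet_form a C (\sum_(i in X) mu i *: v i) = 0.
  by rewrite mu0 -(scale0r (0 : 'rV[R]_(d + 1))) facet_formZ mul0r.
rewrite facet_form_sum (big_setD1 b)//= (big_setD1 b')//= big1 ?addr0; last first.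
  by move=> i iC; rewrite facet_form_mem ?mulr0.
move/eqP; rewrite addr_eq0 => /eqP fb.
by rewrite XbE Xb'E !detB_facet_form// -!normrM fb normrN.
Qed.

(** By [detB_ratio] the quotient of [|mu b|] by the determinant of [X :\ b] does not depend on b as
    long as [mu b] is nonzero. Each term is therefore a common constant [K] times the sign of
    [mu b], present exactly when eliminating b leaves nonnegative weights. *)
Lemma spline_relation0 X mu : #|X| = d.+2 -> \sum_(i in X) mu i *: v i = 0 ->
  \sum_(b in X) mu b * M 0 (X :\ b)%SET x = 0.
Proof.
move=> cX mu0; have [aX|nX] := pselect (aff_spans a X); last first.
  rewrite big1// => b bX; rewrite spline_nspan ?mulr0// => aXb.
  by apply: nX; apply: aff_spansW aXb; exact: subsetDl.
have [[b0 b0X mub0]|nmu] := pselect (exists2 b, b \in X & mu b != 0); last first.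
  rewrite big1// => b bX; have [->|mub] := eqVneq (mu b) 0; first by rewrite mul0r.
  by exfalso; apply: nmu; exists b.
have [c [c1 xc]] := aX x; have /(lift1_sumP a) cx := conj c1 (esym xc).
have cXb b : b \in X -> #|(X :\ b)%SET| = d.+1.
  by move=> bX; move: cX; rewrite (cardsD1 b) bX => -[].
have aXb b : b \in X -> mu b != 0 -> aff_indep a (X :\ b)%SET.
  move=> bX mub; apply: aff_spans_indep; rewrite ?cXb//.
  exact: aff_spans_elim mu0.
pose K := d`!%:R * (`|mu b0| / detB a (X :\ b0)%SET).
pose ok b := [forall i in X, 0 <= c i - c b / mu b * mu i].
have ME b : b \in X ->
    mu b * M 0 (X :\ b)%SET x = K * (if (mu b != 0) && ok b then Num.sg (mu b) else 0).
  move=> bX; case: eqVneq => [->|mub] /=; first by rewrite mul0r mulr0.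
  have aXb' := aXb b bX mub; rewrite asboolT; last first.
    by apply: aff_indep_spans => //; exact: cXb.
  have okP : conv_hull a (X :\ b)%SET x <-> ok b.
    have cxb := etrans (sum_elim c bX mub mu0) cx.
    rewrite (conv_hull_coords aXb' cxb); split=> [c0|/'forall_implyP c0 i].
      apply/'forall_implyP => i iX; have [->|ib] := eqVneq i b.
        by rewrite divfK// subrr.
      by apply: c0; rewrite !inE ib.
    by rewrite !inE => /andP[_]; exact: c0.
  have KE : K = d`!%:R * (`|mu b| / detB a (X :\ b)%SET).
    have d0 : detB a (X :\ b0)%SET != 0.
      by rewrite gt_eqF// detB_gt0 ?cXb//; exact: aXb.
    have d1 : detB a (X :\ b)%SET != 0 by rewrite gt_eqF// detB_gt0 ?cXb.
    rewrite /K; congr (_ * _); apply/eqP; rewrite eqr_div//; apply/eqP.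
    by rewrite (detB_ratio cX mu0).
  rewrite indicE; case okb: (ok b).
    rewrite mem_set; last exact/okP.
    by rewrite mulr1 KE {1}[mu b]numEsg; ring.
  rewrite memNset ?mulr0// => /okP; by rewrite okb.
rewrite (eq_bigr _ ME) -mulr_sumr -big_mkcondr/= sum_sg_segment_ends ?mulr0//.
  by have [] := (sum_lift1_eq0 a _ _).1 mu0.
(* Two coordinates vanishing together would put x in the span of d points. *)
move=> b i bX iX ib mub.
apply: (@generic_coord_neq0 (X :\ b)%SET i (fun i => c i - c b / mu b * mu i)).
- by rewrite cXb.
- by rewrite !inE ib.
by rewrite (sum_elim c bX mub mu0).
Qed.

(** The weights [c] and the coordinates in [beta X], extended by 0, represent the same point; their
    difference is a dependence, whose contribution vanishes by the relation in degree k. *)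
Lemma spline_recursion_of_relation k :
  (forall X mu, #|X| = (k + d).+2 -> \sum_(i in X) mu i *: v i = 0 ->
    \sum_(b in X) mu b * M k (X :\ b)%SET x = 0) ->
  forall X c, #|X| = (k + d).+2 -> \sum_(i in X) c i *: v i = lift1 x ->
  M k.+1 X x = (k.+1 + d)%:R / k.+1%:R * \sum_(b in X) c b * M k (X :\ b)%SET x.
Proof.
move=> rel X c cX cx; have [aX|nX] := pselect (aff_spans a X); last first.
  rewrite spline_nspan// big1 ?mulr0// => b bX; rewrite spline_nspan ?mulr0// => aXb.
  by apply: nX; apply: aff_spansW aXb; exact: subsetDl.
have [BX cB aB] := hbeta aX.
have [t xt] := coords_exist (lift1 x) aB cB.
rewrite /= asboolT//; congr (_ * _).
transitivity (\sum_(b in beta X) t b * M k (X :\ b)%SET x).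
  apply: eq_bigr => b bB; rewrite (detB_subst_coords aB cB xt bB).
  by rewrite [_ * t b]mulrC mulfK// gt_eqF// detB_gt0.
pose t' i := if i \in beta X then t i else 0.
have mu0 : \sum_(i in X) (c i - t' i) *: v i = 0.
  under eq_bigr do rewrite scalerBl.
  rewrite sumrB cx xt -(sum_if_subset _ BX); apply/eqP; rewrite subr_eq0; apply/eqP/eq_bigr => i _.
  by rewrite /t'; case: ifP; rewrite ?scale0r.
have /= := rel X _ cX mu0; under eq_bigr do rewrite mulrBl.
rewrite sumrB => /eqP; rewrite subr_eq0 => /eqP->; rewrite -(sum_if_subset _ BX).
by apply: eq_bigr => b _; rewrite /t'; case: ifP; rewrite ?mul0r.
Qed.

(** Each spline on [X :\ b] is expanded with the weights of x from which b has been eliminated. The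
    resulting summand [F b b'] is antisymmetric in b and b', so the double sum equals its
    opposite. *)
Lemma spline_relation k X mu :
  #|X| = (k + d).+2 -> \sum_(i in X) mu i *: v i = 0 ->
  \sum_(b in X) mu b * M k (X :\ b)%SET x = 0.
Proof.
elim: k X mu => [|k IH] X mu cX mu0; first exact: spline_relation0.
have [aX|nX] := pselect (aff_spans a X); last first.
  rewrite big1// => b bX; rewrite spline_nspan ?mulr0// => aXb.
  by apply: nX; apply: aff_spansW aXb; exact: subsetDl.
have [c [c1 xc]] := aX x; have /(lift1_sumP a) cx := conj c1 (esym xc).
pose K : R := (k.+1 + d)%:R / k.+1%:R.
pose F b b' := (mu b * c b' - c b * mu b') * M k (X :\ b :\ b')%SET x.
have ME b : b \in X -> mu b * M k.+1 (X :\ b)%SET x =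
    K * \sum_(b' in (X :\ b)%SET) F b b'.
  move=> bX; have cXb : #|(X :\ b)%SET| = (k + d).+2.
    by move: cX; rewrite (cardsD1 b) bX => -[].
  (* Here b cannot be eliminated, but [mu] is already a dependence on [X :\ b] and the induction
     hypothesis makes the right-hand side 0. *)
  have [mub|mub] := eqVneq (mu b) 0.
    rewrite mub mul0r (eq_bigr (fun b' => - c b * (mu b' * M k (X :\ b :\ b')%SET x))).
      by rewrite -mulr_sumr IH ?mulr0// -sum_coord0.
    by move=> b' _; rewrite /F mub; ring.
  rewrite (spline_recursion_of_relation IH cXb (etrans (sum_elim c bX mub mu0) cx)).
  rewrite mulrCA; congr (_ * _); rewrite mulr_sumr; apply: eq_bigr => b' _.
  by rewrite /F; field.
rewrite (eq_bigr _ ME) -mulr_sumr; set S := \sum_(b in X) _.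
suff S0 : S = - S by rewrite (_ : S = 0) ?mulr0//; lra.
rewrite {1}/S (exchange_big_dep (mem X))/=; last first.
  by move=> b b' bX; rewrite !inE => /andP[].
rewrite -sumrN; apply: eq_bigr => b' b'X; rewrite -sumrN.
apply: eq_big => [b|b _].
  by rewrite !inE eq_sym b'X andbT andbC.
rewrite /F (_ : (X :\ b' :\ b = X :\ b :\ b')%SET); first by ring.
by apply/setP => i; rewrite !inE andbCA.
Qed.

Lemma spline_recursion k X c :
  #|X| = (k + d).+2 -> \sum_(i in X) c i *: v i = lift1 x ->
  M k.+1 X x = (k.+1 + d)%:R / k.+1%:R * \sum_(b in X) c b * M k (X :\ b)%SET x.
Proof. exact/spline_recursion_of_relation/spline_relation. Qed.

End Splines.

(** * Facets of a fine tiling *)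

Lemma le_of_small (R : realType) (l t e : R) :
  (forall D, 0 < D -> exists2 eps, 0 < eps < D & l <= t + eps * e) -> l <= t.
Proof.
move=> small; rewrite leNgt; apply/negP => tl.
have e0 : 0 < `|e| + 1 by rewrite ltr_wpDl.
have [|eps /andP[eps0 epsD] le] := small ((l - t) / (`|e| + 1)).
  by rewrite divr_gt0// subr_gt0.
rewrite ltr_pdivlMr// in epsD.
have : eps * e <= eps * `|e| by rewrite ler_wpM2l ?ler_norm// ltW.
nra.
Qed.

Section Tilings.
Context {R : realType} {d n : nat}.
Variables (a : 'I_n -> 'rV[R]_d) (P : {set {set 'I_n} * {set 'I_n}}).
Hypothesis hP : fine_tiling a P.
Implicit Types (C J : {set 'I_n}) (L F : {set 'I_n} * {set 'I_n}) (i b : 'I_n).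
Implicit Types (t e : 'I_n -> R) (p w y : 'rV[R]_(d + 1)).

Local Notation v i := (lift1 (a i)).

(** The weights are not confined to [0, 1]: every point of the space has such coordinates with
    respect to every tile. *)
Definition tile_point L t : 'rV[R]_(d + 1) :=
  \sum_(i in L.1) v i + \sum_(b in L.2) t b *: v b.

Lemma tileP L t : (forall b, b \in L.2 -> 0 <= t b <= 1) -> tile a L (tile_point L t).
Proof.
move=> t01; exists (fun b => if b \in L.2 then t b else 0) => [b|].
  by case: ifP => [/t01//|_]; rewrite lexx ler01.
by congr (_ + _); apply: eq_bigr => b ->.
Qed.

Lemma tile_point_inj L t e : is_tile a L -> tile_point L t = tile_point L e ->
  forall b, b \in L.2 -> t b = e b.
Proof. by move=> [_ _ aL] /addrI; exact: aff_indep_inj. Qed.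

Lemma tile_point_coords L p : is_tile a L -> exists t, p = tile_point L t.
Proof.
move=> [_ cL aL]; have [t tE] := coords_exist (p - \sum_(i in L.1) v i) aL cL.
by exists t; rewrite /tile_point -tE addrC subrK.
Qed.

Lemma tile_point_move L t e eps : tile_point L (fun b => t b + eps * e b) =
  tile_point L t + eps *: \sum_(b in L.2) e b *: v b.
Proof.
rewrite /tile_point -addrA; congr (_ + _); rewrite scaler_sumr -big_split/=.
by apply: eq_bigr => b _; rewrite scalerA scalerDl.
Qed.

(** Since finitely many tiles cover the segment, one of them contains points [p + eps *: w] for
    arbitrarily small eps; tiles being closed, it contains p too. *)
Lemma tile_ray p w : (forall eps, 0 <= eps <= 1 -> zonotope a (p + eps *: w)) ->
  exists L t e, [/\ L \in P, p = tile_point L t, w = \sum_(b in L.2) e b *: v b &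
    exists2 eps, 0 < eps & forall b, b \in L.2 ->
      0 <= t b <= 1 /\ 0 <= t b + eps * e b <= 1].
Proof.
move=> zon.
pose near0 L := forall D, 0 < D ->
  exists2 eps, 0 < eps < D & tile a L (p + eps *: w).
have [[L LP nL]|nnear] := pselect (exists2 L, L \in P & near0 L); last first.
  have /choice[D D0] L : exists D : R, 0 < D /\ (L \in P ->
      forall eps, 0 < eps < D -> ~ tile a L (p + eps *: w)).
    have [LP|] := boolP (L \in P); last by exists 1.
    apply: contrapT => nD; apply: nnear; exists L => // D D0.
    apply: contrapT => neps; apply: nD; exists D; split=> // _ eps epsD Leps.
    by apply: neps; exists eps.
  (* Otherwise no tile meets the ray strictly between 0 and the least threshold [m], which
     contradicts the covering. *)
  pose m := \big[Num.min/1]_(L in P) D L.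
  have m0 : 0 < m by apply: lt_bigmin => // L _; have [] := D0 L.
  have m1 : m <= 1 by exact: bigmin_le_id.
  have /zon : 0 <= m / 2 <= 1 by lra.
  rewrite -(tiling_cover hP) => -[L /= LP]; have [_ /(_ LP (m / 2))] := D0 L.
  move=> nt Lt; case: (nt _ Lt); apply/andP; split; first by lra.
  have : m <= D L by exact: bigmin_le_cond.
  lra.
have tL := tiling_tiles hP LP; have [_ cL aL] := tL.
have [t pE] := tile_point_coords p tL; have [e wE] := coords_exist w aL cL.
have coords eps b : tile a L (p + eps *: w) -> b \in L.2 -> 0 <= t b + eps * e b <= 1.
  move=> [u u01]; rewrite pE wE -tile_point_move => /(tile_point_inj tL) tu bL.
  by rewrite tu// u01.
exists L, t, e; split=> //; have [eps /andP[eps0 _] Leps] := nL 1 ltr01.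
exists eps => // b bL; split; last exact: coords.
apply/andP; split.
  apply: (@le_of_small _ _ _ (e b)) => D /nL[eps' eps'D /coords/(_ bL)/andP[+ _]].
  by exists eps'.
rewrite -lerN2; apply: (@le_of_small _ _ _ (- e b)).
move=> D /nL[eps' eps'D /coords/(_ bL)/andP[_ +]].
by exists eps' => //; rewrite mulrN -opprD lerN2.
Qed.

Lemma facet_form_continuous C : continuous (facet_form a C).
Proof.
have -> : facet_form a C = fun y => \sum_j y 0 j * facet_form a C (delta_mx 0 j).
  by apply/funext => y; rewrite {1}[y]row_sum_delta facet_form_sum.
apply: continuous_big => [|j _ y]; first exact: add_continuous.
exact: cvgMl (@coord_continuous R 1 (d + 1) 0 j y).
Qed.

(** Each coordinate in the tile is a quotient of facet forms, hence continuous, so strict bounds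
    persist nearby. *)
Lemma tile_interior L t : is_tile a L -> (forall b, b \in L.2 -> 0 < t b < 1) ->
  ((tile a L)° (tile_point L t))%classic.
Proof.
move=> tL t01; have [_ cL aL] := tL; pose y := tile_point L t.
pose s := \sum_(i in L.1) v i.
pose g b y := facet_form a (L.2 :\ b)%SET (y - s) / facet_form a (L.2 :\ b)%SET (v b).
have gE b u : b \in L.2 -> g b (tile_point L u) = u b.
  move=> bL; rewrite /g /tile_point addrC addKr.
  have cC : #|(L.2 :\ b)%SET| = d by move: cL; rewrite (cardsD1 b) bL => -[].
  have bC : b \notin (L.2 :\ b)%SET by rewrite !inE eqxx.
  have := facet_form_basis a u cC bC; rewrite finset.setD1K// => ->.
  rewrite mulfK//.
  by rewrite facet_form_neq0// finset.setD1K.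
have g_near b : \forall y' \near y, b \in L.2 -> 0 < g b y' < 1.
  have [bL|_] := boolP (b \in L.2); last by near=> y'.
  have cg : {for y, continuous (g b)}.
    have cs : {for y, continuous (fun z : 'rV[R]_(d + 1) => z - s)}.
      exact: cvgB cvg_id (cvg_cst s).
    exact: cvgMl (continuous_comp cs (@facet_form_continuous _ _)).
  have gy : g b y \in `]0, 1[ by rewrite in_itv/= gE// t01.
  have gn : \forall z \near y, g b z \in `]0, 1[ := cg _ (near_in_itvoo gy).
  near=> z => _; have : g b z \in `]0, 1[ by near: z.
  by rewrite in_itv.
have g01 : \forall z \near y, forall b, b \in L.2 -> 0 < g b z < 1.
  exact: (filter_forall _ g_near).
rewrite /interior/=; near=> y'.
have gy' : forall b, b \in L.2 -> 0 < g b y' < 1 by near: y'.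
have [u yu] := tile_point_coords y' tL.
rewrite yu; apply: tileP => b bL; have := gy' b bL.
by rewrite yu gE// => /andP[/ltW-> /ltW->].
Unshelve. all: by end_near. Qed.

Lemma tile_eq_of_interior L L' t t' : L \in P -> L' \in P ->
  tile_point L t = tile_point L' t' -> (forall b, b \in L.2 -> 0 < t b < 1) ->
  (forall b, b \in L'.2 -> 0 < t' b < 1) -> L = L'.
Proof.
move=> LP L'P tt' t01 t'01; apply/eqP; apply: contraT => LL'.
have := tiling_interiors hP LP L'P LL'; rewrite -subset0.
case/(_ (tile_point L t)); split.
  by apply: tile_interior => //; exact: tiling_tiles LP.
by rewrite tt'; apply: tile_interior => //; exact: tiling_tiles L'P.
Qed.

End Tilings.

Section Facets.
Context {R : realType} {d n : nat}.
Variables (a : 'I_n -> 'rV[R]_d) (P : {set {set 'I_n} * {set 'I_n}}).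
Hypothesis hP : fine_tiling a P.
Implicit Types (C J : {set 'I_n}) (L F : {set 'I_n} * {set 'I_n}) (i b : 'I_n).
Implicit Types (t e : 'I_n -> R) (p w y : 'rV[R]_(d + 1)) (u : bool).

Local Notation v i := (lift1 (a i)).

Lemma tile_pointE L t : tile_point a L t =
  \sum_i ((i \in L.1)%:R + (if i \in L.2 then t i else 0)) *: v i.
Proof.
under eq_bigr do rewrite scalerDl; rewrite big_split/=; congr (_ + _).
  by rewrite big_mkcond; apply: eq_bigr => i _; case: ifP; rewrite ?scale1r ?scale0r.
by rewrite big_mkcond; apply: eq_bigr => i _; case: ifP; rewrite ?scale0r.
Qed.

(** In the coordinates of the tile, an index of [L.2] outside [F.2] is frozen at 1 if it belongs to
    [F.1] and at 0 otherwise. *)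
Lemma face_point L F t : is_tile a L -> is_face F L ->
  tile_point a F t = tile_point a L (fun i => if i \in F.2 then t i else (i \in F.1)%:R).
Proof.
move=> [L12 _ _] [FL2 LF1 FL1]; rewrite !tile_pointE; apply: eq_bigr => i _.
congr (_ *: _); have := fintype.subsetP FL2 i; have := fintype.subsetP LF1 i.
have := fintype.subsetP FL1 i; rewrite !inE.
have := disjointFr L12 (x := i).
case: (i \in F.1); case: (i \in F.2); case: (i \in L.1); case: (i \in L.2) => //=;
  rewrite ?addr0 ?add0r//.
all: try by move=> /(_ isT).
all: try by move=> _ /(_ isT).
all: try by move=> _ _ /(_ isT).
all: try by move=> _ _ _ /(_ isT).
Qed.

(** [u] selects the upper facet, where coordinate b is 1, or the lower one, where it is 0. *)
Definition facet_of L b u : {set 'I_n} * {set 'I_n} :=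
  ((if u then b |: L.1 else L.1)%SET, (L.2 :\ b)%SET).

(* The sign of the side of the hyperplane of the facet on which the tile lies,
   given by [facet_form]. *)
Definition side L b u : R :=
  (if u then -1 else 1) * Num.sg (facet_form a (L.2 :\ b)%SET (v b)).

Lemma facet_of_face L b u : is_tile a L -> b \in L.2 -> is_face (facet_of L b u) L.
Proof.
move=> [L12 _ _] bL; have bL1 := disjointFl L12 bL.
rewrite /facet_of; split=> /=; first exact: subsetDl.
  by case: u => //; exact: finset.subsetUr.
case: u; last exact: finset.subsetUl.
apply/fintype.subsetP => i; rewrite !inE => /orP[/eqP->|->//].
by rewrite eqxx bL andbT orbT.
Qed.

Lemma card_facet_of L b u : is_tile a L -> b \in L.2 -> #|(facet_of L b u).2| = d.
Proof. by move=> [_ cL _] bL; move: cL; rewrite (cardsD1 b) bL => -[]. Qed.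

Lemma mem_facet_of L b u : is_tile a L -> b \in L.2 -> (b \in (facet_of L b u).1) = u.
Proof.
by move=> [L12 _ _] bL; case: u; rewrite /= ?inE ?eqxx// (disjointFl L12 bL).
Qed.

Lemma facet_of_neq0 L b : is_tile a L -> b \in L.2 ->
  facet_form a (L.2 :\ b)%SET (v b) != 0.
Proof.
move=> tL bL; have [_ _ aL] := tL.
apply: facet_form_neq0; rewrite ?(card_facet_of false tL bL)//.
  by rewrite !inE eqxx.
by rewrite finset.setD1K.
Qed.

Definition mid_facet F := tile_point a F (fun=> 2^-1).

(** For i outside [F.2] the weight of i on the face is 1 or 0, and the sign makes the direction move
    this weight into [0, 1], that is, stay in the zonotope. *)
Definition outward F i : 'rV[R]_(d + 1) := (if i \in F.1 then -1 else 1) *: v i.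

Lemma outward_zonotope F i eps : [disjoint F.1 & F.2]%B -> i \notin F.2 ->
  0 <= eps <= 1 -> zonotope a (mid_facet F + eps *: outward F i).
Proof.
move=> F12 iF2 eps01; pose s : R := if i \in F.1 then -1 else 1.
exists (fun j => (j \in F.1)%:R + (if j \in F.2 then 2^-1 else 0) +
    (if j == i then eps * s else 0)) => [j|].
  have := disjointFr F12 (x := j); rewrite /s.
  case: eqP => [->|_].
    by rewrite (negPf iF2) addr0; case: (i \in F.1) => _; rewrite ?mulr1n ?mulr0n; lra.
  by case: (j \in F.1); case: (j \in F.2); rewrite ?mulr1n ?mulr0n ?addr0 ?add0r => h;
    [move: (h isT)|lra..].
rewrite /mid_facet tile_pointE; under [RHS]eq_bigr do rewrite scalerDl.
rewrite big_split/=; congr (_ + _); rewrite (bigD1 i)//= eqxx big1 ?addr0.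
  by rewrite /outward scalerA.
by move=> j /negPf->; rewrite scale0r.
Qed.

(** Coordinate b is 0 or 1 on the facet, so a direction that stays in the tile can only increase it
    in the first case and decrease it in the second. *)
Lemma sg_facet_coord L b u t e eps : is_tile a L -> b \in L.2 ->
  mid_facet (facet_of L b u) = tile_point a L t -> 0 < eps ->
  0 <= t b + eps * e b <= 1 ->
  facet_form a (L.2 :\ b)%SET (\sum_(i in L.2) e i *: v i) != 0 ->
  side L b u = Num.sg (facet_form a (L.2 :\ b)%SET (\sum_(i in L.2) e i *: v i)).
Proof.
move=> tL bL pt eps0 te; set C := (L.2 :\ b)%SET.
have cC : #|C| = d := card_facet_of u tL bL.
have bC : b \notin C by rewrite !inE eqxx.
have := facet_form_basis a e cC bC; rewrite finset.setD1K// => ->.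
rewrite mulf_eq0 negb_or sgrM /side -/C => /andP[eb _]; congr (_ * _).
have tb : t b = u%:R.
  rewrite -(tile_point_inj tL (etrans (esym (face_point _ tL (facet_of_face u tL bL))) pt) bL).
  by rewrite (negPf bC) mem_facet_of.
move: te eb; rewrite tb; case: u {pt tb} => /=.
  by move=> te eb; rewrite ltr0_sg// lt_neqAle eb/=; nra.
by move=> te eb; rewrite gtr0_sg// lt_neqAle eq_sym eb/=; nra.
Qed.

Lemma facet_of_point L p F t : is_tile a L -> is_face F L -> p = tile_point a F t ->
  forall e, p = tile_point a L e -> forall i, i \in L.2 ->
  e i = if i \in F.2 then t i else (i \in F.1)%:R.
Proof.
move=> tL FL pF e pL i iL.
by rewrite (tile_point_inj tL (etrans (esym pL) (etrans pF (face_point t tL FL))) iL).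
Qed.

(** The ray from the middle of the facet in direction [outward] starts in some tile [L'], which
    meets [L] in a common face containing the middle. That face cannot be smaller than the facet, so
    the facet belongs to [L'], and [sg_facet_coord] gives its side. *)
Lemma facet_other_tile L b u i : L \in P -> b \in L.2 -> i \notin L.2 :\ b ->
  facet_form a (L.2 :\ b)%SET (outward (facet_of L b u) i) != 0 ->
  exists L' b' u', [/\ L' \in P, b' \in L'.2, facet_of L' b' u' = facet_of L b u &
    side L' b' u' = Num.sg (facet_form a (L.2 :\ b)%SET (outward (facet_of L b u) i))].
Proof.
move=> LP bL iC hi; have tL := tiling_tiles hP LP; have [L12 cL aL] := tL.
set G := facet_of L b u; have GL : is_face G L := facet_of_face u tL bL.
have G12 : [disjoint G.1 & G.2]%B.
  rewrite disjoint_subset; apply/fintype.subsetP => j; rewrite !inE negb_and negbK.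
  have := disjointFr L12 (x := j); rewrite /G /=.
  by case: (u); rewrite ?inE => jL; case: eqP => //= _ /jL->.
have [L' [t' [e' [L'P pt' we' [eps eps0 te']]]]] :=
  tile_ray hP (fun eps => @outward_zonotope G i eps G12 iC).
have tL' := tiling_tiles hP L'P; have [L'12 cL' aL'] := tL'.
pose p := mid_facet G.
have pL : tile a L p.
  rewrite /p /mid_facet (face_point _ tL GL); apply: tileP => j _.
  by case: ifP => _; [lra|case: (_ \in _); rewrite ?lexx ?ler01].
have pL' : tile a L' p by rewrite /p pt'; apply: tileP => j /te'[].
have [LL'0|[F [FL FL' LL'F]]] := tiling_faces hP LP L'P.
  by have : set0 p by rewrite -LL'0.
have [tau _ pF] : tile a F p by rewrite -LL'F.
have {}pF : p = tile_point a F tau by [].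
have coordL j : j \in L.2 ->
    (if j \in G.2 then 2^-1 else (j \in G.1)%:R) =
    if j \in F.2 then tau j else (j \in F.1)%:R.
  exact: (facet_of_point tL FL pF (face_point _ tL GL)).
have GF2 : G.2 \subset F.2.
  (* An index of the facet has weight 1/2, whereas an index outside [F.2] would have weight 0 or
     1. *)
  apply/fintype.subsetP => j jG; have [GL2 _ _] := GL.
  have := coordL j (fintype.subsetP GL2 j jG); rewrite jG; case: ifP => // _.
  by case: (_ \in _) => /= h; exfalso; move: h; rewrite ?mulr1n ?mulr0n; lra.
have [FL'2 L'F1 FL'1] := FL'; have [FL2 LF1 FL1] := FL.
suff [b' [u' [b'L' G']]] : exists b' u', b' \in L'.2 /\ facet_of L' b' u' = G.
  exists L', b', u'; split=> //.
  have G2 : (L'.2 :\ b')%SET = (L.2 :\ b)%SET := congr1 snd G'.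
  have ptG : mid_facet (facet_of L' b' u') = tile_point a L' t' by rewrite G'.
  have := sg_facet_coord tL' b'L' ptG eps0 (te' _ b'L').2; rewrite -we' G2.
  exact.
(* Either [F.2] is all of [L.2], and then [L'] is [L], or [F] is the facet itself. *)
have [bF|bF] := boolP (b \in F.2).
  have F2L : F.2 = L.2.
    apply/eqP; rewrite finset.eqEsubset FL2/=; apply/fintype.subsetP => j jL.
    have [->//|jb] := eqVneq j b; apply: (fintype.subsetP GF2).
    by rewrite !inE jb.
  have F2L' : F.2 = L'.2.
    by apply/eqP; rewrite eqEcard FL'2 F2L cL cL' /=.
  exists b, u; rewrite -F2L'; split=> //.
  have F1 (K : {set 'I_n} * {set 'I_n}) : is_face F K -> F.2 = K.2 -> F.1 = K.1.
    move=> [_ KF FK] FK2; apply/eqP; rewrite finset.eqEsubset KF andbT.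
    by move: FK; rewrite FK2 finset.setDv finset.setU0.
  by rewrite /G /facet_of -F2L' F2L -(F1 _ FL F2L) -(F1 _ FL' F2L').
have F2G : F.2 = G.2.
  apply/eqP; rewrite finset.eqEsubset GF2 andbT; apply/fintype.subsetP => j jF.
  rewrite !inE (fintype.subsetP FL2)// andbT.
  by apply: contraNneq bF => <-.
have F1G : F.1 = G.1.
  apply/setP => j; have [jL|jL] := boolP (j \in L.2); last first.
    have [_ LG GLb] := GL.
    have := fintype.subsetP FL1 j; have := fintype.subsetP LF1 j.
    have := fintype.subsetP LG j; have := fintype.subsetP GLb j.
    rewrite !inE (negPf jL) !andbF !orbF => h1 h2 h3 h4.
    by apply/idP/idP => [/h4/h2|/h1/h3].
  have [jb|jb] := eqVneq j b.
    have := coordL b bL; rewrite -F2G (negPf bF) jb.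
    by case: (b \in G.1); case: (b \in F.1) => // /eqP; rewrite ?eqr_nat.
  have jG2 : j \in G.2 by rewrite !inE jb.
  rewrite (disjointFl G12 jG2); apply/negP => /(fintype.subsetP FL1).
  by rewrite !inE F2G jG2 (disjointFl L12 jL).
have [b' b'E] : exists b', b' \in (L'.2 :\: G.2)%SET.
  apply/set0Pn; rewrite -card_gt0 cardsD -F2G (finset.setIidPr FL'2) cL' F2G.
  by rewrite (card_facet_of u tL bL) subSnn.
move: b'E; rewrite inE => /andP[b'G b'L'].
exists b', (b' \in G.1); split=> //.
have G2E : (L'.2 :\ b')%SET = G.2.
  apply/eqP; rewrite eq_sym eqEcard; apply/andP; split.
    rewrite -F2G; apply/fintype.subsetP => j jF; rewrite !inE (fintype.subsetP FL'2)// andbT.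
    by apply: contraNneq b'G => <-; rewrite -F2G.
  rewrite (card_facet_of u tL bL) -ltnS -cL' [leqRHS](cardsD1 b') b'L'.
  by rewrite add1n.
rewrite [RHS]surjective_pairing /facet_of G2E; congr (_, _).
apply/setP => j; have [->|jb] := eqVneq j b'.
  by case: ifP => bG; rewrite ?finset.setU11// (disjointFl L'12 b'L').
have -> : (j \in if b' \in G.1 then b' |: L'.1 else L'.1)%SET = (j \in L'.1).
  by case: ifP => _; rewrite ?in_setU1 ?(negPf jb).
rewrite -F1G; apply/idP/idP => [/(fintype.subsetP L'F1)//|/(fintype.subsetP FL'1)].
rewrite finset.in_setU finset.in_setD => /orP[//|/andP[jF jL']].
by case/negP: jF; rewrite F2G -G2E in_setD1 jb.
Qed.

End Facets.

(** * Cancellation of the tiles sharing a facet *)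

Section FacetCancellation.
Context {R : realType} {d n : nat}.
Variables (a : 'I_n -> 'rV[R]_d) (P : {set {set 'I_n} * {set 'I_n}}).
Hypothesis hP : fine_tiling a P.
Implicit Types (L : {set 'I_n} * {set 'I_n}) (b : 'I_n) (u : bool).

Local Notation v i := (lift1 (a i)).

Lemma side_pm1 L b u : is_tile a L -> b \in L.2 -> side a L b u = 1 \/ side a L b u = -1.
Proof.
move=> tL bL; have := facet_of_neq0 tL bL; rewrite /side.
case: u; case: sgrP => // _ _; rewrite ?mulr1 ?mulrN1 ?mulN1r ?opprK; by [left|right].
Qed.

(** A point slightly off the middle of the facet, on the common side, is interior to both tiles, so
    the tiles coincide. *)
Lemma facet_unique L L' b b' u u' : L \in P -> L' \in P -> b \in L.2 -> b' \in L'.2 ->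
  facet_of L b u = facet_of L' b' u' -> side a L b u = side a L' b' u' ->
  (L, b, u) = (L', b', u').
Proof.
move=> LP L'P bL b'L' GG' sLL'.
have tL := tiling_tiles hP LP; have tL' := tiling_tiles hP L'P.
have [_ cL' aL'] := tL'; set G := facet_of L b u in GG'.
have CC' : (L'.2 :\ b' = L.2 :\ b)%SET := esym (congr1 snd GG').
pose w := outward a G b; pose s : R := if u then -1 else 1.
have bG : (b \in G.1) = u := mem_facet_of u tL bL.
have b'G : (b' \in G.1) = u' by rewrite GG' (mem_facet_of u' tL' b'L').
pose t i : R := if i \in G.2 then 2^-1 else (i \in G.1)%:R.
pose e i : R := if i == b then s else 0.
have wL : w = \sum_(i in L.2) e i *: v i.
  rewrite (big_setD1 b)//= big1 ?addr0 => [|i].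
    by rewrite /w /outward bG /e eqxx.
  by rewrite !inE => /andP[/negPf ib _]; rewrite /e ib scale0r.
have pL : mid_facet a G = tile_point a L t.
  exact: face_point tL (facet_of_face u tL bL).
have pL' : mid_facet a G = tile_point a L' t.
  have GL' : is_face G L' by rewrite GG'; exact: (facet_of_face u' tL' b'L').
  exact: face_point tL' GL'.
have [e' wL'] := coords_exist w aL' cL'.
have cC : #|(L'.2 :\ b')%SET| = d := card_facet_of u' tL' b'L'.
have b'C : b' \notin (L'.2 :\ b')%SET by rewrite !inE eqxx.
have fw : facet_form a (L'.2 :\ b')%SET w = e' b' * facet_form a (L'.2 :\ b')%SET (v b').
  have := facet_form_basis a e' cC b'C; rewrite finset.setD1K// => <-.
  by rewrite wL'.
have se' : Num.sg (e' b') = if u' then -1 else 1.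
  have ff := facet_of_neq0 tL' b'L'.
  have sff : Num.sg (facet_form a (L'.2 :\ b')%SET (v b')) != 0 by rewrite sgr_eq0.
  apply: (mulIf sff); rewrite -sgrM -fw CC' /w /outward bG facet_formZ.
  rewrite sgrM -CC' -[RHS]/(side a L' b' u') -sLL' /side CC'.
  by case: (u); rewrite ?sgrN sgr1.
(* [eps] keeps all displacements below 1/2: coordinates starting at 1/2 stay strictly inside [0, 1],
   as do those moving inwards from 0 or 1. *)
pose S := \sum_i `|e' i|; pose eps : R := (2 * (2 + S))^-1.
have S0 : 0 <= S by exact: sumr_ge0.
have e'S i : `|e' i| <= S by rewrite /S (bigD1 i)//= lerDl sumr_ge0.
have D0 : 0 < 2 * (2 + S) by lra.
have eps0 : 0 < eps by rewrite invr_gt0.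
have epsS i : `|eps * e' i| < 2^-1.
  rewrite normrM gtr0_norm// /eps mulrC ltr_pdivrMr//.
  by have := e'S i; lra.
have eps1 : eps < 2^-1 by rewrite /eps ltf_pV2 ?posrE//; lra.
have LL' : L = L'.
  apply: (@tile_eq_of_interior _ _ _ _ _ hP L L' (fun i => t i + eps * e i)
    (fun i => t i + eps * e' i)) => // [|i iL|i iL'].
  - by rewrite !tile_point_move -pL pL' -wL -wL'.
  - rewrite /t /e; have [->|ib] := eqVneq i b.
      rewrite !inE eqxx/= -/(facet_of L b u).1 -/G bG /s.
      by case: (u); rewrite ?mulr1n ?mulr0n; lra.
    by rewrite !inE ib iL /=; lra.
  rewrite /t; have := epsS i; rewrite ltr_norml => /andP[].
  have [->|ib'] := eqVneq i b'.
    rewrite GG' (negPf b'C) -GG' b'G; move: se'.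
    case: u' {sLL' GG' b'G} => /= se'.
      have : e' b' < 0 by rewrite -sgr_lt0 se' ltrN10.
      by nra.
    have : 0 < e' b' by rewrite -sgr_gt0 se' ltr01.
    by nra.
  by rewrite GG' !inE ib' iL' /=; lra.
subst L'; have bb' : b = b'.
  have : b \notin (L.2 :\ b')%SET by rewrite CC' !inE eqxx.
  by rewrite !inE bL andbT negbK => /eqP.
by rewrite -bb' -bG bb' b'G.
Qed.

(** Each term is the side of the tile times the form of [C] at x. If each tile faces one on the
    other side, the sides cancel. Otherwise the facet lies on the boundary, its hyperplane separates
    J from the remaining points, and x, being in both hulls, lies on it. *)
Lemma facet_cancel J C x : conv_hull a (~: J)%SET x -> conv_hull a (J :|: C)%SET x ->
  \sum_(T : ({set 'I_n} * {set 'I_n}) * 'I_n * bool |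
      [&& T.1.1 \in P, T.1.2 \in T.1.1.2 & facet_of T.1.1 T.1.2 T.2 == (J, C)])
    (if T.2 then -1 else 1) * detB_subst a T.1.1.2 T.1.2 x = 0.
Proof.
move=> xJ xJC; pose f := facet_form a C; 
pose A (T : ({set 'I_n} * {set 'I_n}) * 'I_n * bool) :=
  [&& T.1.1 \in P, T.1.2 \in T.1.1.2 & facet_of T.1.1 T.1.2 T.2 == (J, C)].
transitivity (\sum_(T | A T) side a T.1.1 T.1.2 T.2 * f (lift1 x)).
  apply: eq_bigr => -[[L b] u] /and3P[/= LP bL /eqP GE].
  have tL := tiling_tiles hP LP.
  have C_E : (L.2 :\ b)%SET = C := congr1 snd GE.
  rewrite -[in LHS](finset.setD1K bL) detB_subst_facet_form.
  - by rewrite mulrA /side /f C_E.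
  - exact: card_facet_of u tL bL.
  - by rewrite !inE eqxx.
rewrite -mulr_suml.
have [opp|nopp] := pselect (forall T, A T -> exists2 T', A T' &
    side a T'.1.1 T'.1.2 T'.2 = - side a T.1.1 T.1.2 T.2).
  rewrite sum_signs ?mul0r//.
    by move=> [[L b] u] /and3P[/= LP bL _]; apply: side_pm1 => //; exact: tiling_tiles LP.
  move=> [[L b] u] [[L' b'] u'] /and3P[/= LP bL /eqP GE] /and3P[/= L'P b'L' /eqP GE'] ss'.
  by apply: facet_unique => //; rewrite GE GE'.
have [[[L b] u] AT nT] : exists2 T, A T & ~ exists2 T', A T' &
    side a T'.1.1 T'.1.2 T'.2 = - side a T.1.1 T.1.2 T.2.
  apply: contrapT => nex; apply: nopp => T AT; apply: contrapT => nT.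
  by apply: nex; exists T.
move: AT nT => /and3P[/= LP bL /eqP GE] nT; have tL := tiling_tiles hP LP.
have C_E : (L.2 :\ b)%SET = C := congr1 snd GE.
set s := side a L b u in nT *.
have cC : #|C| = d by rewrite -C_E; exact: card_facet_of u tL bL.
have fC i : i \in C -> f (v i) = 0 by exact: facet_form_mem.
(* An outward direction to the empty side would produce the missing tile by [facet_other_tile]. *)
have out i : i \notin C -> 0 <= s * f (outward a (J, C) i).
  move=> iC; rewrite leNgt; apply/negP => sf0; apply: nT.
  have f0 : f (outward a (J, C) i) != 0.
    by apply: contraTneq sf0 => ->; rewrite mulr0 ltxx.
  have := @facet_other_tile _ _ _ a P hP L b u i LP bL.
  rewrite GE C_E => /(_ iC f0)[L' [b' [u' [L'P b'L' G' s']]]].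
  exists (L', b', u') => /=; first by rewrite /A /= L'P b'L' G' eqxx.
  rewrite s'; move: sf0; case: (side_pm1 u tL bL); rewrite -/s => ->.
    by rewrite mul1r => /ltr0_sg.
  by rewrite mulN1r oppr_lt0 opprK => /gtr0_sg.
have sJ i : i \in J -> s * f (v i) <= 0.
  have [iC _|iC iJ] := boolP (i \in C); first by rewrite fC ?mulr0.
  have := out i iC; rewrite /f /outward/= iJ facet_formZ; lra.
have snJ i : i \notin J -> 0 <= s * f (v i).
  have [iC _|iC iJ] := boolP (i \in C); first by rewrite fC ?mulr0.
  by have := out i iC; rewrite /f /outward/= (negPf iJ) facet_formZ mul1r.
suff sf0 : s * f (lift1 x) = 0.
  move/eqP: sf0; rewrite mulf_eq0 => /orP[|/eqP->]; last by rewrite mulr0.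
  by case: (side_pm1 u tL bL); rewrite -/s => ->; rewrite ?oppr_eq0 oner_eq0.
have fE S : conv_hull a S x -> exists2 w, (forall i, 0 <= w i) &
    s * f (lift1 x) = \sum_(i in S) w i * (s * f (v i)).
  move=> [w [w0 w1 xw]]; exists w => //.
  have /(lift1_sumP a) <- := conj w1 (esym xw).
  rewrite /f facet_form_sum mulr_sumr; apply: eq_bigr => i _; ring.
apply/eqP; rewrite eq_le; apply/andP; split.
  have [w w0 ->] := fE _ xJC; apply: sumr_le0 => i; rewrite inE => iJC.
  apply: mulr_ge0_le0 => //; case/orP: iJC => [/sJ//|/fC->].
  by rewrite mulr0.
have [w w0 ->] := fE _ xJ; apply: sumr_ge0 => i; rewrite inE => /snJ.
by apply: mulr_ge0.
Qed.

End FacetCancellation.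

(** * Reproduction *)

Section TileVolume.
Context {R : realType} {d n : nat}.
Variable a : 'I_n -> 'rV[R]_d.

Let d1_gt0 : (0 < d + 1)%N. Proof. by rewrite addn1. Qed.

(** A tile is a translate of the image of the cube under the matrix [rows a L.2]. *)
Lemma vol_tile L : is_tile a L -> vol (tile a L) = detB a L.2.
Proof.
move=> [_ cL aL]; have Lu := rows_unitmx aL cL.
rewrite /vol /detB -normrEsg.
suff -> : tile a L = [set \sum_(i in L.1) lift1 (a i) + y *m rows a L.2 | y in cube].
  by rewrite lebesgue_parallelepiped.
have [r [s [sB rK sK rowsE]]] := rows_indexing a cL.
apply/seteqP; split=> [_ [t t01 ->]|_ [y y01 <-]].
  exists (\row_j t (s j)) => [j|]; first by rewrite !mxE t01.
  by congr (_ + _); rewrite rowsE; apply: eq_bigr => i iL; rewrite mxE sK.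
rewrite rowsE; exists (fun i => y 0 (r i)) => // i.
by have := y01 (r i); rewrite !mxE.
Qed.

Lemma lebesgue_aff_span0 (C : {set 'I_n}) : (0 < d)%N -> (#|C| <= d)%N ->
  lebesgue [set x | exists w, \sum_(i in C) w i *: lift1 (a i) = lift1 x] = 0%E.
Proof.
move=> d0 cC; set S := [set x | _].
pose M := mx_of_rows (m := d + 1) [seq lift1 (a c) | c in C].
have detM : \det M = 0.
  (* [C] has at most d elements, so row d of [M] is the default value 0 of the sequence. *)
  rewrite (expand_det_row _ (Ordinal (ltac:(by rewrite addn1) : (d < d + 1)%N))).
  by rewrite big1// => j _; rewrite mxE nth_default ?mxE ?mul0r// size_map -cardE.
have /det0P[u u0 uM] : \det M^T == 0 by rewrite det_tr detM.
have vu c : c \in C -> lift1 (a c) *m u^T = 0.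
  move=> cC'; have ic : (index c (enum C) < #|C|)%N by rewrite cardE index_mem mem_enum.
  have ic' : (index c (enum C) < d + 1)%N by rewrite addn1 ltnS (leq_trans (ltnW ic)).
  have : row (Ordinal ic') (M *m u^T) = 0.
    by rewrite -[M]trmxK -trmx_mul uM trmx0 row0.
  by rewrite row_mul rowK (nth_map c) -?cardE//= nth_index ?mem_enum.
have xu x : S x -> x *m usubmx u^T = - dsubmx u^T.
  move=> [w wx]; apply/eqP; rewrite -addr_eq0; apply/eqP.
  have <- : lift1 x *m u^T = 0.
    by rewrite -wx mulmx_suml big1// => i iC; rewrite -scalemxAl vu ?scaler0.
  by rewrite -[u^T in RHS]vsubmxK mul_row_col mul1mx.
(* A form involving only the last coordinate is a nonzero constant on lifted points, and then the
   set is empty; otherwise it lies in a hyperplane. *)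
have [u'0|u'0] := eqVneq (usubmx u^T) 0.
  suff -> : S = set0 by exact: lebesgue_set0.
  rewrite -subset0 => x /xu; rewrite u'0 mulmx0 => /eqP; rewrite eq_sym oppr_eq0.
  move=> /eqP u''0; move/eqP: u0; apply; apply: trmx_inj.
  by rewrite -[LHS]vsubmxK u'0 u''0 col_mx0 trmx0.
apply/eqP; rewrite eq_le lebesgue_ge0 andbT.
rewrite -(lebesgue_hyperplane d0 ((- dsubmx u^T) 0 0) u'0).
by apply: le_lebesgue => x /xu /= ->.
Qed.

Lemma ae_generic : (0 < d)%N -> lebesgue [set x | ~ generic a x] = 0%E.
Proof.
move=> d0; pose S (C : {set 'I_n}) :=
  [set x | exists w, \sum_(i in C) w i *: lift1 (a i) = lift1 x].
apply: (@lebesgue_bigcup0 _ _ _ (fun C : {set 'I_n} => (#|C| <= d)%N) S) => //.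
  move=> x ngen; apply: contrapT => nS; apply: ngen => C w cC wx.
  by apply: nS; exists C => //; exists w.
by move=> C; exact: lebesgue_aff_span0.
Qed.

End TileVolume.

(** [f - f 0] is linear: homogeneity comes from lines through 0, additivity from midpoints. *)
Lemma affine_comb (R : realType) (d : nat) (I : finType) (A : pred I)
    (f : 'rV[R]_d -> R) (t : I -> R) (p : I -> 'rV[R]_d) :
  (forall u v s, f ((1 - s) *: u + s *: v) = (1 - s) * f u + s * f v) ->
  \sum_(i | A i) t i = 1 ->
  f (\sum_(i | A i) t i *: p i) = \sum_(i | A i) t i * f (p i).
Proof.
move=> fA t1; pose g u := f u - f 0.
have gZ s u : g (s *: u) = s * g u.
  by have := fA 0 u s; rewrite scaler0 add0r /g => ->; ring.
have gD u v : g (u + v) = g u + g v.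
  have -> : u + v = 2 *: ((1 - 2^-1) *: u + 2^-1 *: v).
    by rewrite scalerDr !scalerA (_ : 2 * (1 - 2^-1) = 1) ?divff ?scale1r//; field.
  by rewrite gZ /g fA; field.
have gsum : g (\sum_(i | A i) t i *: p i) = \sum_(i | A i) t i * g (p i).
  elim/big_rec2: _ => [|i y1 y2 _ <-]; first by rewrite /g subrr.
  by rewrite gD gZ.
have fg u : f u = g u + f 0 by rewrite /g subrK.
rewrite fg gsum; under [RHS]eq_bigr do rewrite fg mulrDr.
by rewrite big_split/= -mulr_suml t1 mul1r.
Qed.

Section Reproduction.
Context {R : realType} {d n : nat}.
Variables (a : 'I_n -> 'rV[R]_d) (P : {set {set 'I_n} * {set 'I_n}}).
Variable beta : {set 'I_n} -> {set 'I_n}.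
Hypotheses (hP : fine_tiling a P) (hbeta : basis_choice a beta).
Variable x : 'rV[R]_d.
Hypothesis gen : generic a x.
Implicit Types (L : {set 'I_n} * {set 'I_n}) (b : 'I_n) (u : bool).

Local Notation v i := (lift1 (a i)).
Local Notation M k X := (spline a beta k X x).

(** A tile containing the start of the ray from 0 through the lift of x has order 0, because
    nonnegative weights summing to 0 vanish. It is unique, as half the lift of x would be interior
    to any two such tiles. *)
Lemma order0_tile : conv_hull a [set: 'I_n]%SET x ->
  \sum_(L in P | #|L.1| == 0) (\1_(conv_hull a L.2) x : R) = 1.
Proof.
move=> [w [w0 w1 xw]].
have wx : \sum_(i in [set: 'I_n]%SET) w i *: v i = lift1 x.
  exact: (lift1_sumP a _ _ _).2 (conj w1 (esym xw)).
have w_le1 i : w i <= 1.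
  by rewrite -w1 (big_setD1 i) ?inE//= lerDl sumr_ge0.
have zon eps : 0 <= eps <= 1 -> zonotope a (0 + eps *: lift1 x).
  move=> /andP[e0 e1]; exists (fun i => eps * w i) => [i|].
    by rewrite mulr_ge0//= mulr_ile1.
  rewrite add0r -wx scaler_sumr; apply: eq_big => [i|i _]; first by rewrite inE.
  by rewrite scalerA.
have [L [t [e [LP p0 xe [eps eps0 te]]]]] := tile_ray hP zon.
have tL := tiling_tiles hP LP; have [_ cL aL] := tL.
have t0 b : b \in L.2 -> 0 <= t b by move=> /te[/andP[]].
pose s i : R := (i \in L.1)%:R + (if i \in L.2 then t i else 0).
have s0 i : s i = 0.
  have [sum0 _] : \sum_i s i = 0 /\ \sum_i s i *: a i = 0.
    by apply/sum_lift1_eq0; rewrite -tile_pointE -p0.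
  apply: (psumr_eq0P _ sum0) => // j _.
  by rewrite addr_ge0 ?ler0n//; case: ifP => // /t0.
have [L12 _ _] := tL.
have L10 : L.1 = finset.set0.
  apply/setP => i; rewrite inE; apply/negP => iL; have := s0 i.
  by rewrite /s iL (disjointFr L12 iL) addr0 => /eqP; rewrite oner_eq0.
have tb0 b : b \in L.2 -> t b = 0.
  by move=> bL; have := s0 b; rewrite /s bL L10 inE add0r.
have xL : conv_hull a L.2 x.
  apply/(conv_hull_coords aL (esym xe)) => b bL; have [_] := te b bL.
  by rewrite tb0// add0r => /andP[]; rewrite pmulr_rge0.
have strict L' : is_tile a L' -> conv_hull a L'.2 x -> L'.1 = finset.set0 ->
    exists2 t', 2^-1 *: lift1 x = tile_point a L' t' & forall b, b \in L'.2 -> 0 < t' b < 1.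
  move=> [_ cL' aL'] [u [u0 u1 xu]] L'10.
  have ux : \sum_(i in L'.2) u i *: v i = lift1 x.
    exact: (lift1_sumP a _ _ _).2 (conj u1 (esym xu)).
  exists (fun b => 2^-1 * u b).
    rewrite /tile_point L'10 finset.big_set0 add0r -ux scaler_sumr.
    by apply: eq_bigr => i _; rewrite scalerA.
  move=> b bL'; have ub : u b != 0.
    by apply: (generic_coord_neq0 gen _ bL' ux); rewrite cL'.
  have : 0 < u b by rewrite lt_neqAle eq_sym ub u0.
  have : u b <= 1 by rewrite -u1 (bigD1 b)//= lerDl sumr_ge0.
  by lra.
rewrite (bigD1 L)/= ?LP ?L10 ?cards0 ?eqxx// indicE mem_set// big1 ?addr0//.
move=> L' /andP[/andP[L'P /eqP/cards0_eq L'10] L'L].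
rewrite indicE memNset// => xL'.
have [t1 t1E t1s] := strict L tL xL L10.
have [t2 t2E t2s] := strict L' (tiling_tiles hP L'P) xL' L'10.
move/eqP: L'L; apply; apply: (tile_eq_of_interior hP L'P LP _ t2s t1s).
by rewrite -t1E -t2E.
Qed.

(** The recursion is used in the basis [L.2] instead of [beta], and Cramer's rule turns the
    coordinates of x into determinants. *)
Lemma tile_spline_recursion k L : is_tile a L -> #|L.1| = k.+1 ->
  detB a L.2 * M k.+1 (L.1 :|: L.2)%SET = (k.+1 + d)%:R / k.+1%:R *
  \sum_(b in L.2) detB_subst a L.2 b x * M k (L.1 :|: (L.2 :\ b))%SET.
Proof.
move=> [L12 cL aL] cL1; have [t xt] := coords_exist (lift1 x) aL cL.
pose c i := if i \in L.2 then t i else 0.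
have L2X : L.2 \subset (L.1 :|: L.2)%SET by exact: finset.subsetUr.
have cX : #|(L.1 :|: L.2)%SET| = (k + d).+2.
  by rewrite cardsU disjoint_setI0// cards0 subn0 cL1 cL addnS.
have cx : \sum_(i in (L.1 :|: L.2)%SET) c i *: v i = lift1 x.
  rewrite xt -(sum_if_subset _ L2X); apply: eq_bigr => i _; rewrite /c.
  by case: ifP => // _; rewrite scale0r.
rewrite (spline_recursion hbeta gen cX cx) mulrCA; congr (_ * _).
rewrite mulr_sumr -(sum_if_subset _ L2X); apply: eq_bigr => b _; rewrite /c.
case: ifP => bL; last by rewrite mul0r mulr0.
rewrite mulrA -(detB_subst_coords aL cL xt bL); congr (_ * spline _ _ _ _ _).
apply/setP => i; rewrite !inE.
by case: eqVneq => [->|//] /=; rewrite (disjointFl L12 bL).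
Qed.

End Reproduction.

(** * Induction on the degree *)

Section Induction.
Context {R : realType} {d n : nat}.
Variables (a : 'I_n -> 'rV[R]_d) (P : {set {set 'I_n} * {set 'I_n}}).
Variable beta : {set 'I_n} -> {set 'I_n}.
Hypotheses (hP : fine_tiling a P) (hbeta : basis_choice a beta).
Variable x : 'rV[R]_d.
Hypothesis gen : generic a x.
Implicit Types (L : {set 'I_n} * {set 'I_n}) (b : 'I_n) (u : bool).
Implicit Types (G : seq 'rV[R]_d -> R).

Local Notation v i := (lift1 (a i)).
Local Notation M k X := (spline a beta k X x).
Local Notation facet_flag := (({set 'I_n} * {set 'I_n}) * 'I_n * bool)%type.

(* Polar forms are evaluated on the sequence of their arguments. *)
Definition symmetric_on k G := forall s t, size s = k -> perm_eq s t -> G s = G t.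

Definition affine_on k G := forall s p q (t : R), (size s).+1 = k ->
  G ((1 - t) *: p + t *: q :: s) = (1 - t) * G (p :: s) + t * G (q :: s).

Lemma conv_k_le k : (k < n)%N -> conv_k a k.+1 x -> conv_k a k x.
Proof.
move=> kn xk S /= cS; have /card_gt0P[i iS] : (0 < #|S|)%N by rewrite cS subn_gt0.
apply: (@conv_hullW _ _ _ _ (S :\ i)%SET); first exact: subsetDl.
by apply: xk => /=; move: cS; rewrite (cardsD1 i) iS subnS => <-.
Qed.

Lemma sum_facet_flags (f : facet_flag -> R) (B : pred facet_flag) :
  \sum_(T : facet_flag | [&& T.1.1 \in P, T.1.2 \in T.1.1.2 & B T]) f T =
  \sum_(L in P) \sum_(b in L.2) (if B (L, b, true) then f (L, b, true) else 0) +
  \sum_(L in P) \sum_(b in L.2) (if B (L, b, false) then f (L, b, false) else 0).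
Proof.
rewrite -big_split/=; rewrite big_mkcond/=.
pose F T := if [&& T.1.1 \in P, T.1.2 \in T.1.1.2 & B T] then f T else 0.
have -> : \sum_T F T = \sum_L \sum_b \sum_u F (L, b, u).
  by rewrite !pair_bigA/=; apply: eq_bigr => -[[]].
rewrite /F /=.
rewrite [RHS]big_mkcond/=; apply: eq_bigr => L _; case: ifP => LP; last first.
  by rewrite big1// => b _; rewrite big1.
rewrite -big_split/= [RHS]big_mkcond; apply: eq_bigr => b _.
case: ifP => bL; last by rewrite big1.
by rewrite big_bool.
Qed.

(** The signed sum over all facets [(J, C)] with [#|J| = k.+1] vanishes facet by facet. Its lower
    facets come from the tiles of order k + 1, its upper ones, with sign -1, from the tiles of order
    k. *)
Lemma facet_level_sum k G : symmetric_on k.+1 G -> conv_k a k.+1 x ->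
  \sum_(L in P | #|L.1| == k.+1) G [seq a i | i in L.1] *
    \sum_(b in L.2) detB_subst a L.2 b x * M k (L.1 :|: (L.2 :\ b))%SET =
  \sum_(L in P | #|L.1| == k) M k (L.1 :|: L.2)%SET *
    \sum_(b in L.2) detB_subst a L.2 b x * G (a b :: [seq a i | i in L.1]).
Proof.
move=> symG xk.
pose H (F : {set 'I_n} * {set 'I_n}) := G [seq a i | i in F.1] * M k (F.1 :|: F.2)%SET.
pose facet (T : facet_flag) := facet_of T.1.1 T.1.2 T.2.
pose term (T : facet_flag) : R := (if T.2 then -1 else 1) * detB_subst a T.1.1.2 T.1.2 x.
pose B (T : facet_flag) := #|(facet T).1| == k.+1.
have : \sum_(T : facet_flag | [&& T.1.1 \in P, T.1.2 \in T.1.1.2 & B T])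
    term T * H (facet T) = 0.
  rewrite (partition_big facet xpredT)//= big1// => -[J C] _.
  under eq_bigr => T /andP[_ /eqP->] do [].
  rewrite -mulr_suml.
  have [cJ|cJ] := eqVneq #|J| k.+1; last first.
    rewrite big_pred0 ?mul0r// => T; apply/negP => /andP[/and3P[_ _ /eqP BT] /eqP FE].
    by move: cJ; rewrite -BT FE eqxx.
  (* Outside the hull of J and C the spline itself is 0; inside it, [facet_cancel] applies, since
     the complement of J has n - k - 1 elements. *)
  have [xJC|/spline_supp nJC] := pselect (conv_hull a (J :|: C)%SET x); last first.
    by rewrite /H nJC !mulr0.
  have xJ : conv_hull a (~: J)%SET x.
    apply: xk => /=; have JC := cardsC J.
    by rewrite -[X in (X - _)%N](card_ord n) -JC cJ addKn.
  suff -> : \sum_(T | [&& T.1.1 \in P, T.1.2 \in T.1.1.2 & B T] && (facet T == (J, C)))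
      term T = 0 by rewrite mul0r.
  rewrite -[RHS](facet_cancel hP xJ xJC).
  apply: eq_big => [T|//]; rewrite -!andbA; congr (_ && (_ && _)).
  by rewrite andb_idl// => /eqP FE; rewrite /B FE cJ.
rewrite sum_facet_flags => /eqP; rewrite addr_eq0 => /eqP E.
transitivity (\sum_(L in P) \sum_(b in L.2)
    if B (L, b, false) then term (L, b, false) * H (facet (L, b, false)) else 0).
  rewrite big_mkcondr; apply: eq_bigr => L _; rewrite /B /=.
  case: ifP => _; last by rewrite big1.
  rewrite mulr_sumr; apply: eq_bigr => b _.
  by rewrite /term /H /facet /facet_of/= mul1r mulrCA.
apply: oppr_inj; rewrite -E big_mkcondr -sumrN; apply: eq_bigr => L LP.
have tL := tiling_tiles hP LP; have [L12 cL aL] := tL.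
have B_E b : b \in L.2 -> B (L, b, true) = (#|L.1| == k).
  by move=> bL; rewrite /B /facet /facet_of/= cardsU1 (disjointFl L12 bL) add1n eqSS.
case: ifP => cL1; last by rewrite oppr0 big1// => b bL; rewrite B_E// cL1.
rewrite mulr_sumr -sumrN; apply: eq_bigr => b bL; rewrite B_E// cL1.
rewrite /term /H /facet /facet_of/=.
have -> : (b |: L.1 :|: L.2 :\ b)%SET = (L.1 :|: L.2)%SET.
  by apply/setP => i; rewrite !inE; case: eqVneq => [->|]; rewrite ?bL ?orbT.
have -> : G [seq a i | i in (b |: L.1)%SET] = G (a b :: [seq a i | i in L.1]).
  apply: symG; first by rewrite size_map -cardE cardsU1 (disjointFl L12 bL) (eqP cL1).
  rewrite -[_ :: _]/(map a (b :: enum L.1)); apply: perm_map; apply: uniq_perm.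
  - exact: enum_uniq.
  - by rewrite /= mem_enum (disjointFl L12 bL) enum_uniq.
  - by move=> i; rewrite mem_enum in_setU1 inE mem_enum.
by ring.
Qed.

Lemma spline_reproduction k G : symmetric_on k G -> affine_on k G ->
  (k + d < n)%N -> conv_k a k x ->
  G (nseq k x) = k`!%:R / (k + d)`!%:R *
    \sum_(L in P | #|L.1| == k) G [seq a i | i in L.1] * detB a L.2 *
      M k (L.1 :|: L.2)%SET.
Proof.
elim: k G => [|k IH] G symG affG kn xk.
  have x0 : conv_hull a [set: 'I_n]%SET x by apply: xk; rewrite /= cardsT card_ord subn0.
  transitivity (G [::] * \sum_(L in P | #|L.1| == 0) (\1_(conv_hull a L.2) x : R)).
    by rewrite order0_tile// mulr1.
  rewrite !mulr_sumr; apply: eq_bigr => L /andP[LP /eqP/cards0_eq L10].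
  have [_ cL aL] := tiling_tiles hP LP.
  have s0 : size [seq a i | i in L.1] = 0 by rewrite size_map -cardE L10 cards0.
  rewrite (size0nil s0) L10 finset.set0U /= asboolT; last exact: aff_indep_spans.
  have dB : detB a L.2 != 0 by rewrite gt_eqF// detB_gt0.
  have dF : d`!%:R != 0 :> R by rewrite pnatr_eq0 -lt0n fact_gt0.
  by rewrite fact0 add0n; field; rewrite dB dF.
have kn' : (k < n)%N by rewrite (leq_trans _ kn)// addSn ltnS leqW// leq_addr.
(* Fixing one argument at x leaves a symmetric affine form in k arguments, to which the induction
   hypothesis applies. *)
pose G' s := G (x :: s).
have symG' : symmetric_on k G'.
  by move=> s t sk st; apply: symG; rewrite /= ?sk// perm_cons.
have affG' : affine_on k G'.
  move=> s p q t sk.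
  have swap (w : 'rV[R]_d) : G' (w :: s) = G (w :: x :: s).
    apply: symG; first by rewrite /= sk.
    by rewrite -(cat1s w) -(cat1s x) -[X in perm_eq _ X](cat1s w) perm_catCA.
  by rewrite !swap affG//= sk.
rewrite -[LHS]/(G' (nseq k x)) (IH G' symG' affG' _ (conv_k_le kn' xk)); last first.
  by rewrite (leq_trans _ kn)// addSn.
have -> : \sum_(L in P | #|L.1| == k.+1) G [seq a i | i in L.1] * detB a L.2 *
      M k.+1 (L.1 :|: L.2)%SET =
    (k.+1 + d)%:R / k.+1%:R * \sum_(L in P | #|L.1| == k) G' [seq a i | i in L.1] *
      detB a L.2 * M k (L.1 :|: L.2)%SET.
  transitivity ((k.+1 + d)%:R / k.+1%:R *
      \sum_(L in P | #|L.1| == k.+1) G [seq a i | i in L.1] *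
      \sum_(b in L.2) detB_subst a L.2 b x * M k (L.1 :|: (L.2 :\ b))%SET).
    rewrite mulr_sumr; apply: eq_bigr => L /andP[LP /eqP cL1].
    rewrite -mulrA (tile_spline_recursion hbeta gen (tiling_tiles hP LP) cL1).
    by rewrite mulrCA.
  rewrite (facet_level_sum symG xk); congr (_ * _).
  apply: eq_bigr => L /andP[LP /eqP cL1]; have [_ cL aL] := tiling_tiles hP LP.
  have [t xt] := coords_exist (lift1 x) aL cL.
  (* The barycentric coordinates of x in [L.2] expand the argument x of [G], which is affine
     there. *)
  have [t1 xE] := (lift1_sumP a _ _ _).1 (esym xt).
  have GA p q s : G ((1 - s) *: p + s *: q :: [seq a i | i in L.1]) =
      (1 - s) * G (p :: [seq a i | i in L.1]) + s * G (q :: [seq a i | i in L.1]).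
    by apply: affG; rewrite size_map -cardE cL1.
  rewrite /G' -[X in G (X :: _)]xE (affine_comb (f := fun p => G (p :: _)) _ GA t1).
  rewrite mulrC; congr (_ * _); rewrite mulr_suml; apply: eq_bigr => b bL.
  by rewrite (detB_subst_coords aL cL xt bL); ring.
rewrite mulrA; congr (_ * _).
have kd : (k + d)`!%:R != 0 :> R by rewrite pnatr_eq0 -lt0n fact_gt0.
have k1 : k.+1%:R != 0 :> R by rewrite pnatr_eq0.
have kd1 : (k + d).+1%:R != 0 :> R by rewrite pnatr_eq0.
by rewrite addSn !factS !natrM; field;
  rewrite kd !nat1r -natrD nat1r k1 kd1.
Qed.

End Induction.

Theorem theorem2p3 (R : realType) (d n : nat) (hd : (1 <= d)%N)
  (a : 'I_n -> 'rV[R]_d) (ha : aff_spans a [set: 'I_n]%SET)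
  (P : {set {set 'I_n} * {set 'I_n}}) (hP : fine_tiling a P)
  (k : nat) (hk : (k + d + 1 <= n)%N)
  (beta : {set 'I_n} -> {set 'I_n}) (hbeta : basis_choice a beta)
  (q : mpoly.mpoly d R) (hq : deg_le k q)
  (Q : ('I_k -> 'rV[R]_d) -> R) (hQ : polar_form q Q) :
  ae_in (conv_k a k) (fun x =>
    peval q x =
      k`!%:R / (k + d)`!%:R *
      \sum_(L in P | #|L.1| == k)
        Q (fun j : 'I_k => [seq a i | i in L.1]`_j) * vol (tile a L) *
        spline a beta k (L.1 :|: L.2) x).
Proof.
pose G (s : seq 'rV[R]_d) := Q (fun j : 'I_k => s`_j).
have [symQ affQ diagQ] := hQ.
have symG : symmetric_on k G.
  move=> s t sk st; have tk : size t == k by rewrite -(perm_size st) sk.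
  have /tuple_permP[p sE] : perm_eq s (Tuple tk) by [].
  rewrite /G -[RHS](symQ p); congr Q; apply/funext => j.
  by rewrite sE -tnth_nth tnth_mktuple (tnth_nth 0).
have affG : affine_on k G.
  move=> s u v t sk; have k0 : (0 < k)%N by rewrite -sk.
  (* The leading 0 is a placeholder, overwritten by [w]. *)
  have GE w : G (w :: s) = Q [eta (fun j : 'I_k => (0 :: s)`_j) with Ordinal k0 |-> w].
    by rewrite /G; congr Q; apply/funext => -[[|j] jk].
  by rewrite !GE affQ.
have GE x : G (nseq k x) = peval q x.
  by rewrite -diagQ /G; congr Q; apply/funext => j; rewrite nth_nseq ltn_ord.
(* The formula can fail only at nongeneric points, which form a null set. *)
apply/eqP; rewrite eq_le lebesgue_ge0 andbT -(ae_generic a hd).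
apply: le_lebesgue => x [xk nE] gen; apply: nE.
have kn : (k + d < n)%N by rewrite -addn1.
rewrite -GE (spline_reproduction hP hbeta gen symG affG kn xk); congr (_ * _).
by apply: eq_bigr => L /andP[LP _]; rewrite vol_tile//; exact: tiling_tiles LP.
Qed.
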